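(* Let $t_0>0$. Let $(\mathcal U(t))_{t\ge0}$ and $(\mathcal V(t))_{t\ge0}$ be two semigroups on $\mathscr L(E)$ left implemented by the $C_0$-semigroups $(T(t))_{t\ge0}$ and $(S(t))_{t\ge0}$ on a Banach space $E$, respectively. Denote the generators of $(\mathcal U(t))_{t\ge0}$ and $(T(t))_{t\ge0}$ by $(\mathcal G,D(\mathcal G))$ and $(A,D(A))$, respectively. The following are equivalent: (i) There exists $\mathcal K\in\mathcal S^{DS,\tau_{\mathrm{sot}}}_{t_0}(\mathcal U)$ such that $(\mathcal V(t))_{t\ge0}$ is generated by $(\mathcal G_{-1}+\mathcal K)_{|\mathscr L(E)}$. (ii) There exists $B\in\mathcal S^{DS}_{t_0}(T)$ such that $(S(t))_{t\ge0}$ is generated by $(A_{-1}+B)_{|E}$.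
   Context: **Setting.** $E$ is a Banach space, $\mathscr L(E)$ its bounded operators, $\tau_{\mathrm{sot}}$ the strong operator topology. The growth bound of $(T(t))_{t\ge0}$ is assumed to satisfy $\omega_0(T)<0$. A semigroup $(\mathcal U(t))_{t\ge0}$ on $\mathscr L(E)$ is left implemented by a $C_0$-semigroup $(T(t))_{t\ge0}$ on $E$ if $\mathcal U(t)C=T(t)C$ for all $t\ge0$, $C\in\mathscr L(E)$. Such semigroups are $\tau_{\mathrm{sot}}$-bi-continuous. **Bi-continuous semigroups on $\mathscr L(E)$.** A set of bounded operators on $\mathscr L(E)$ is bi-equicontinuous if it maps each norm-bounded $\tau_{\mathrm{sot}}$-null sequence to $\tau_{\mathrm{sot}}$-null sequences uniformly over the set. A $\tau_{\mathrm{sot}}$-bi-continuous semigroup is an exponentially bounded one-parameter semigroup $(\mathcal T(t))_{t\ge0}$ of bounded operators on $\mathscr L(E)$ such that $t\mapsto\mathcal T(t)C$ is $\tau_{\mathrm{sot}}$-continuous for each $C$ and $\{\mathcal T(t):t\in[0,s]\}$ is bi-equicontinuous for every $s>0$. Its generator is $C\mapsto\tau_{\mathrm{sot}}\text{-}\lim_{t\to0}\frac{\mathcal T(t)C-C}{t}$ on the set of $C$ for which this limit exists and $\sup_{t\in(0,1]}\frac{\|\mathcal T(t)C-C\|}{t}<\infty$. **Extrapolation.** $E_{-1}=E_{-1}(A)$ is the completion of $E$ for $\|x\|_{-1}=\|A^{-1}x\|$; $T_{-1}(t)$ is the continuous extension of $T(t)$ to $E_{-1}$, a $C_0$-semigroup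 with generator $A_{-1}$, $D(A_{-1})=E$, and $A_{-1}:E\to E_{-1}$ is an isometric isomorphism extending $A$. The extrapolation space of $(\mathcal U(t))$ is $\mathscr L(E,E_{-1})$, with the operator norm and, as locally convex topology $\tau_{-1}$, the strong operator topology; $\mathcal U_{-1}(t)C=T_{-1}(t)C$ for $C\in\mathscr L(E,E_{-1})$, and its generator $\mathcal G_{-1}$, with domain $\mathscr L(E)$, is the extension of $\mathcal G$ given by $\mathcal G_{-1}C=A_{-1}C$. **Admissibility for $\mathcal U$.** $\mathfrak X_{t_0}$ is the Banach space of functions $F:[0,t_0]\to\mathscr L(\mathscr L(E))$ that are norm bounded, such that $t\mapsto F(t)C$ is $\tau_{\mathrm{sot}}$-continuous for each $C\in\mathscr L(E)$, and $\{F(t):t\in[0,t_0]\}$ is bi-equicontinuous; norm $\sup_t\|F(t)\|$. For a linear $\mathcal K:\mathscr L(E)\to\mathscr L(E,E_{-1})$ that is norm bounded and continuous for the strong operator topologies, let $(V_{\mathcal K}F)(t)C=\int_0^t\mathcal U_{-1}(t-r)\mathcal KF(r)C\,\mathrm dr$ ($\tau_{-1}$-Riemann integral). $\mathcal K\in\mathcal S^{DS,\tau_{\mathrm{sot}}}_{t_0}(\mathcal U)$ means: $(V_{\mathcal K}F)(t)C\in\mathscr L(E)$ for all $F\in\mathfrak X_{t_0}$, $t\in[0,t_0]$, $C\in\mathscr L(E)$; $V_{\mathcal K}$ maps $\mathfrak X_{t_0}$ into $\mathfrak X_{t_0}$; and $\|V_{\mathcal K}\|<1$. $(\mathcal G_{-1}+\mathcal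 K)_{|\mathscr L(E)}$ is $\mathcal G_{-1}+\mathcal K$ with domain $\{C\in\mathscr L(E):\mathcal G_{-1}C+\mathcal KC\in\mathscr L(E)\}$. **Admissibility for $T$.** $\mathrm C([0,t_0],\mathscr L_{\mathrm{sot}}(E))$ is the Banach space of strongly continuous functions $[0,t_0]\to\mathscr L(E)$ with norm $\sup_t\|F(t)\|$. $\mathcal S^{DS}_{t_0}(T)$ is the set of $B\in\mathscr L(E,E_{-1})$ such that $(V_BF)(t)x:=\int_0^tT_{-1}(t-r)BF(r)x\,\mathrm dr$ defines a bounded operator $V_B$ of $\mathrm C([0,t_0],\mathscr L_{\mathrm{sot}}(E))$ into itself with $\|V_B\|<1$. $(A_{-1}+B)_{|E}$ is $A_{-1}+B$ with domain $\{x\in E:A_{-1}x+Bx\in E\}$. *)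

(* Defs.v *)
From HB Require Import structures.
From mathcomp Require Import all_boot all_order all_algebra.
From mathcomp Require Import all_classical all_reals all_analysis.
From mathcomp Require Import complex.

Set Implicit Arguments.
Unset Strict Implicit.
Unset Printing Implicit Defensive.

Import Order.TTheory GRing.Theory Num.Theory.
Import numFieldNormedType.Exports.

Local Open Scope classical_set_scope.
Local Open Scope ring_scope.

(** Banach spaces may be real or complex: they are modules over [scalars R k],
    which is [R] or [R[i]].  MathComp norms take values in the scalar field;
    [rnorm] is the same norm, read in [R]. *)
Variant scalar_kind := RealScalars | ComplexScalars.

Definition scalars (R : realType) (k : scalar_kind) : numFieldType :=
  match k with
  | RealScalars => R
  | ComplexScalars => R[i]
  end.

Definition ofR (R : realType) (k : scalar_kind) : R -> scalars R k :=
  match k with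
  | RealScalars => fun r => r
  | ComplexScalars => fun r => r%:C%C
  end.

Definition toR (R : realType) (k : scalar_kind) : scalars R k -> R :=
  match k with
  | RealScalars => fun z => z
  | ComplexScalars => fun z => complex.Re z
  end.
Arguments ofR {R} k _ : simpl never.
Arguments toR {R k} _ : simpl never.

Section scalars_theory.
Variables (R : realType) (k : scalar_kind).
Local Notation K := (scalars R k).
Implicit Types (r : R) (z : K).

Lemma ofRK : cancel (@ofR R k) (@toR R k).
Proof. by case: k. Qed.

Lemma toRD : {morph (@toR R k) : z w / z + w}.
Proof. by case: k => // -[? ?] [? ?]. Qed.

Lemma ofRD : {morph (@ofR R k) : r s / r + s}.
Proof. by case: k => // r s; rewrite /ofR rmorphD. Qed.

Lemma ofRM : {morph (@ofR R k) : r s / r * s}.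
Proof. by case: k => // r s; rewrite /ofR rmorphM. Qed.

Lemma ofR0 : ofR k (0 : R) = 0.
Proof. by case: k. Qed.

Lemma ofR1 : ofR k (1 : R) = 1.
Proof. by case: k. Qed.

Lemma ler_ofR r s : (ofR k r <= ofR k s) = (r <= s).
Proof. by case: k => //; rewrite /ofR lecR. Qed.

Lemma toR_norm z : ofR k (toR `|z|) = `|z|.
Proof. by case: k z => // z; rewrite normc_def. Qed.

Lemma toR_ge0 z : 0 <= z -> ofR k (toR z) = z.
Proof. by move=> /ger0_norm zE; rewrite -zE toR_norm. Qed.

End scalars_theory.

Section rnorm.
Variables (R : realType) (k : scalar_kind) (E : normedModType (scalars R k)).

Definition rnorm (x : E) : R := toR `|x|.

Lemma rnormE x : ofR k (rnorm x) = `|x|.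
Proof. by rewrite /rnorm toR_ge0. Qed.

Lemma rnorm_ge0 x : 0 <= rnorm x.
Proof. by rewrite -(ler_ofR k) rnormE ofR0. Qed.


Lemma rnorm_le x (c : R) : (rnorm x <= c) = (`|x| <= ofR k c).
Proof. by rewrite -rnormE ler_ofR. Qed.

End rnorm.

Section bounded_operators.
Variables (R : realType) (k : scalar_kind).
Local Notation K := (scalars R k).
Variables E F : normedModType K.

Definition bounded_linear : {pred E -> F} :=
  mem [set f : E -> F |
    linear f /\ exists M : R, forall x, `|f x| <= ofR k M * `|x|].

Lemma bounded_linear_submod : submod_closed bounded_linear.
Proof.
split.
  rewrite inE; split=> [a x y|].
    by rewrite (_ : (0 : E -> F) = cst 0)// /cst scaler0 addr0.
  by exists 0 => x; rewrite (_ : (0 : E -> F) = cst 0)// normr0 ofR0 mul0r.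
move=> a f g; rewrite !inE => -[lf [M fM]] [lg [N gN]].
have aE x : (a *: f + g) x = a *: f x + g x by [].
split=> [b x y|].
  by rewrite !aE lf lg !scalerDr !scalerA [a * b]mulrC addrACA.
exists (toR `|a| * M + N) => x; rewrite aE ofRD ofRM toR_norm mulrDl -mulrA.
apply: (le_trans (ler_normD _ _)); apply: lerD => //.
by rewrite normrZ ler_wpM2l.
Qed.

HB.instance Definition _ := GRing.isSubmodClosed.Build _ _ bounded_linear
  bounded_linear_submod.

Record bop := Bop { bop_fun :> E -> F ; bop_bounded : bop_fun \in bounded_linear }.

HB.instance Definition _ := [isSub for bop_fun].
HB.instance Definition _ := [Choice of bop by <:].
HB.instance Definition _ := [SubChoice_isSubLmodule of bop by <:].

Lemma bopP (f : bop) :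
  linear f /\ exists M : R, forall x, `|f x| <= ofR k M * `|x|.
Proof. by have := bop_bounded f; rewrite inE. Qed.

Lemma bop_linear (f : bop) : linear f.
Proof. by have [] := bopP f. Qed.

HB.instance Definition _ (f : bop) :=
  GRing.isLinear.Build K E F *:%R (bop_fun f) (bop_linear f).

Lemma bop_ext (f g : bop) : (forall x, f x = g x) -> f = g.
Proof. by move=> fg; apply/val_inj/funext. Qed.

Lemma bopDE (f g : bop) x : (f + g) x = f x + g x. Proof. by []. Qed.

Lemma bopZE (a : K) (f : bop) x : (a *: f) x = a *: f x. Proof. by []. Qed.

Lemma bop0E x : (0 : bop) x = 0. Proof. by []. Qed.

Definition opnorm (f : bop) : R :=
  sup [set rnorm (f x) | x in [set x : E | rnorm x <= 1]].

Let opnorm_has_sup (f : bop) :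
  has_sup [set rnorm (f x) | x in [set x : E | rnorm x <= 1]].
Proof.
split.
  by exists (rnorm (f 0)), 0 => //; rewrite /= rnorm_le normr0 ofR1 ler01.
have [_ [M fM]] := bopP f; exists (`|M|) => _ [x x1 <-].
rewrite rnorm_le (le_trans (fM x))//.
rewrite (@le_trans _ _ (ofR k `|M| * `|x|))//.
  by rewrite ler_wpM2r// ler_ofR ler_norm.
rewrite -[leRHS]mulr1 ler_wpM2l//; first by rewrite -(ofR0 R k) ler_ofR.
by rewrite -(ofR1 R k) -rnorm_le.
Qed.

Lemma opnorm_ub (f : bop) x : rnorm x <= 1 -> rnorm (f x) <= opnorm f.
Proof.
move=> x1; apply: sup_upper_bound; first exact: opnorm_has_sup.
by exists x.
Qed.

Lemma opnorm_le (f : bop) (c : R) :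
  (forall x, rnorm x <= 1 -> rnorm (f x) <= c) -> opnorm f <= c.
Proof.
move=> fc; apply: ge_sup; first by case: (opnorm_has_sup f).
by move=> _ [x x1 <-]; exact: fc.
Qed.

Lemma opnorm_ge0 (f : bop) : 0 <= opnorm f.
Proof.
apply: (@le_trans _ _ (rnorm (f 0))); first exact: rnorm_ge0.
by apply: opnorm_ub; rewrite rnorm_le normr0 ofR1 ler01.
Qed.

Lemma ler_opnorm (f : bop) x : `|f x| <= ofR k (opnorm f) * `|x|.
Proof.
have [->|x0] := eqVneq x 0; first by rewrite linear0 !normr0 mulr0.
have nx : 0 < `|x| by rewrite normr_gt0.
have := @opnorm_ub f (`|x|^-1 *: x).
rewrite !rnorm_le linearZ !normrZ gtr0_norm ?invr_gt0// mulVf ?gt_eqF// ofR1.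
by move=> /(_ (lexx _)); rewrite ler_pdivrMl// mulrC.
Qed.

Let norm (f : bop) : K := ofR k (opnorm f).

Let ler_norm_add f g : norm (f + g) <= norm f + norm g.
Proof.
rewrite /norm -ofRD ler_ofR; apply: opnorm_le => x x1.
rewrite rnorm_le bopDE ofRD (le_trans (ler_normD _ _))// lerD//;
  by rewrite -rnorm_le opnorm_ub.
Qed.

Let norm_eq0 f : norm f = 0 -> f = 0.
Proof.
move=> f0; apply: bop_ext => x; apply/eqP; rewrite -normr_le0.
by rewrite (le_trans (ler_opnorm f x))// -/(norm f) f0 mul0r.
Qed.

Let norm_scale (a : K) f : norm (a *: f) = `|a| * norm f.
Proof.
have le_aux b g : norm (b *: g) <= `|b| * norm g.
  rewrite /norm -[X in X * _]toR_norm -ofRM ler_ofR; apply: opnorm_le => x x1.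
  rewrite rnorm_le bopZE normrZ ofRM toR_norm ler_wpM2l//.
  by rewrite -rnorm_le opnorm_ub.
apply/eqP; rewrite eq_le le_aux/=.
have [->|a0] := eqVneq a 0.
  by rewrite normr0 mul0r /norm -(ofR0 R k) ler_ofR opnorm_ge0.
have := le_aux a^-1 (a *: f); rewrite scalerA mulVf// scale1r => fa.
rewrite (le_trans (ler_wpM2l (normr_ge0 a) fa))//.
by rewrite mulrA -normrM mulfV// normr1 mul1r.
Qed.

HB.instance Definition _ := Lmodule_isNormed.Build K bop
  ler_norm_add norm_scale norm_eq0.

End bounded_operators.
Arguments bop {R k} E F.
Arguments bounded_linear {R k} E F.

Section composition.
Variables (R : realType) (k : scalar_kind).
Local Notation K := (scalars R k).

Lemma bop_id_subproof (E : normedModType K) :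
  (id : E -> E) \in bounded_linear E E.
Proof.
by rewrite inE; split=> //; exists 1 => x; rewrite ofR1 mul1r.
Qed.

Definition bop_id (E : normedModType K) : bop E E := Bop (bop_id_subproof E).

Lemma bop_comp_subproof (E F G : normedModType K) (f : bop F G) (g : bop E F) :
  (f \o g) \in bounded_linear E G.
Proof.
rewrite inE; split=> [a x y|]; first by rewrite /= !linearP.
exists (opnorm f * opnorm g) => x.
rewrite ofRM -mulrA (le_trans (ler_opnorm f (g x)))// ler_wpM2l//.
  by rewrite -(ofR0 R k) ler_ofR opnorm_ge0.
exact: ler_opnorm.
Qed.

Definition bop_comp (E F G : normedModType K) (f : bop F G) (g : bop E F) :
  bop E G := Bop (bop_comp_subproof f g).

Lemma lmul_subproof (E F G : normedModType K) (f : bop F G) :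
  (bop_comp f : bop E F -> bop E G)
    \in bounded_linear (bop E F) (bop E G).
Proof.
rewrite inE; split=> [a g h|].
  by apply: bop_ext => x; rewrite /= linearP.
exists (opnorm f) => g.
rewrite -[`|g|]/(ofR k (opnorm g)) -ofRM.
rewrite -[`|bop_comp f g|]/(ofR k (opnorm (bop_comp f g))) ler_ofR.
apply: opnorm_le => x x1; rewrite rnorm_le ofRM (le_trans (ler_opnorm f (g x)))//.
rewrite ler_wpM2l//; first by rewrite -(ofR0 R k) ler_ofR opnorm_ge0.
by rewrite -rnorm_le opnorm_ub.
Qed.

Definition lmul (E F G : normedModType K) (f : bop F G) :
  bop (bop E F) (bop E G) := Bop (lmul_subproof E f).

End composition.

(** [bop E F] with the strong operator topology, that is, the topology of
    pointwise convergence ([bop E F] itself carries the norm topology). *)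
Definition sot (R : realType) (k : scalar_kind)
    (E F : normedModType (scalars R k)) : Type :=
  initial_topology (fun f : bop E F => (f : {ptws E -> F})).

HB.instance Definition _ (R : realType) (k : scalar_kind)
    (E F : normedModType (scalars R k)) :=
  Topological.copy (sot E F)
    (initial_topology (fun f : bop E F => (f : {ptws E -> F}))).

Lemma sot_cvgP (R : realType) (k : scalar_kind)
    (E F : normedModType (scalars R k)) (Phi : set_system (bop E F))
    (f : bop E F) : Filter Phi ->
  (Phi --> (f : sot E F)) <-> forall x, g x @[g --> Phi] --> f x.
Proof.
move=> FPhi; split=> [Phif x|Phif].
  have fc : {for f : sot E F, continuous (fun g : sot E F => (g : {ptws E -> F}))}.
    exact: initial_continuous.
  have := cvg_trans (cvg_app _ Phif) fc.
  by move=> /(pointwise_cvgP _ _) /(_ x).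
have : {ptws, (fun g : bop E F => g : E -> F) @ Phi --> (f : E -> F)}.
  exact/pointwise_cvgP.
move=> Phif' A; rewrite nbhsE => -[_ [[B oB <-] Bf] BA].
apply: (filterS BA); apply: Phif'; exact: open_nbhs_nbhs.
Qed.

Section riemann.
Variable R : realType.

(* The points x_0, .., x_n and the tags c_0, .., c_(n-1). *)
Record tagged_partition := TaggedPartition {
  tp_size : nat ; tp_point : nat -> R ; tp_tag : nat -> R }.

Definition is_tagged_partition (a b : R) (P : tagged_partition) : Prop :=
  [/\ tp_point P 0%N = a, tp_point P (tp_size P) = b &
      forall i, (i < tp_size P)%N ->
        tp_point P i <= tp_tag P i <= tp_point P i.+1].

Definition finer_than (d : R) (P : tagged_partition) : Prop :=
  forall i, (i < tp_size P)%N -> tp_point P i.+1 - tp_point P i < d.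

Definition fine_partitions (a b : R) : set_system tagged_partition :=
  filter_from [set d : R | 0 < d]
    (fun d => [set P | is_tagged_partition a b P /\ finer_than d P]).

Variables (k : scalar_kind).
Local Notation K := (scalars R k).

Definition riemann_sum (V : lmodType K) (f : R -> V) (P : tagged_partition) :
    V :=
  \sum_(i < tp_size P)
    ofR k (tp_point P i.+1 - tp_point P i) *: f (tp_tag P i).

Definition is_riemann_integral (V : normedModType K) (f : R -> V) (a b : R)
    (l : V) : Prop :=
  riemann_sum f P @[P --> fine_partitions a b] --> l.

Definition is_sot_riemann_integral (E F : normedModType K) (f : R -> bop E F)
    (a b : R) (l : bop E F) : Prop :=
  (riemann_sum f P : sot E F) @[P --> fine_partitions a b] --> (l : sot E F).

End riemann.

Section semigroups.
Variables (R : realType) (k : scalar_kind).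
Local Notation K := (scalars R k).

(* One-parameter families (T(t))_{t >= 0} are functions on [R] of which only
   the values at [t >= 0] matter. *)
Definition is_semigroup (X : normedModType K) (T : R -> bop X X) : Prop :=
  T 0 = bop_id X /\
  forall s t, 0 <= s -> 0 <= t -> T (s + t) = bop_comp (T s) (T t).

Definition C0_semigroup (X : normedModType K) (T : R -> bop X X) : Prop :=
  is_semigroup T /\ {within `[0, +oo[, continuous (T : R -> sot X X)}.

Definition growth_bound (X : normedModType K) (T : R -> bop X X) : \bar R :=
  ereal_inf [set w%:E | w in [set w : R | exists2 M : R, 1 <= M &
    forall t, 0 <= t -> rnorm (T t) <= M * expR (w * t)]].

(* Unbounded operators are given by their graphs: [generator T x y] means that
   x is in the domain of the generator A of T and that A x = y. *)
Definition generator (X : normedModType K) (T : R -> bop X X) (x y : X) :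
    Prop :=
  (ofR k t^-1 *: (T t x - x)) @[t --> 0^'+] --> y.

Definition left_implemented (X Y : normedModType K)
    (U : R -> bop (bop X Y) (bop X Y)) (T : R -> bop Y Y) : Prop :=
  is_semigroup U /\ forall t C, 0 <= t -> U t C = bop_comp (T t) C.

(* Also a graph; the has_ubound condition is part of the definition of the
   domain for bi-continuous semigroups. *)
Definition sot_generator (X Y : normedModType K)
    (U : R -> bop (bop X Y) (bop X Y)) (C D : bop X Y) : Prop :=
  ((ofR k t^-1 *: (U t C - C) : sot X Y) @[t --> 0^'+] --> (D : sot X Y)) /\
  has_ubound [set rnorm (U t C - C) / t | t in `]0, 1]].

Definition bi_equicontinuous (X Y : normedModType K)
    (S : set (bop (bop X Y) (bop X Y))) : Prop :=
  forall C : nat -> bop X Y,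
    (exists M : R, forall n, rnorm (C n) <= M) ->
    (C n : sot X Y) @[n --> \oo] --> ((0 : bop X Y) : sot X Y) ->
    forall (x : X) (e : R), 0 < e ->
      \forall n \near \oo, forall U, S U -> rnorm (U (C n) x) < e.

End semigroups.

Section extrapolation.
Variables (R : realType) (k : scalar_kind).
Local Notation K := (scalars R k).
Variables (E : normedModType K).

(* A^-1 y, where A is the generator of T; meaningful when A is invertible *)
Definition generator_inv (T : R -> bop E E) (y : E) : E :=
  xget 0 [set x | generator T x y].

(* Em1, with the embedding [j] of E, is the completion E_{-1} of E for the norm
   |A^-1 y|, and [Tm1 t] is the continuous extension of [T t] to E_{-1}.  The
   operator A_{-1} is [generator Tm1], of domain [j @` E]. *)
Definition is_extrapolation (T : R -> bop E E)
    (Em1 : completeNormedModType K) (j : bop E Em1)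
    (Tm1 : R -> bop Em1 Em1) : Prop :=
  [/\ forall y, rnorm (j y) = rnorm (generator_inv T y),
      dense (range j) &
      forall t x, 0 <= t -> Tm1 t (j x) = j (T t x)].

Section function_spaces.
Variables (t0 : R) (V : normedModType K).
Implicit Types (X : set (R -> V)) (F : R -> V).

(* Functions on [0, t0] are functions on [R] of which only the values in
   [0, t0] matter. *)
Definition sup_norm F : R := sup [set rnorm (F t) | t in `[0, t0]].

(* The operator norm of Phi : X -> X, +oo if Phi is unbounded *)
Definition space_opnorm X (Phi : (R -> V) -> (R -> V)) : \bar R :=
  ereal_sup [set (sup_norm (Phi F))%:E | F in [set F | X F /\ sup_norm F <= 1]].

End function_spaces.

Variables (t0 : R) (Em1 : normedModType K) (j : bop E Em1).
Variable Tm1 : R -> bop Em1 Em1.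

Definition sot_continuous_functions : set (R -> bop E E) :=
  [set F | {within `[0, t0], continuous (F : R -> sot E E)}].

Definition is_VB (B : bop E Em1) (VB : (R -> bop E E) -> (R -> bop E E)) :
    Prop :=
  forall F, sot_continuous_functions F -> forall t x, 0 <= t <= t0 ->
    is_riemann_integral (fun r => Tm1 (t - r) (B (F r x))) 0 t (j (VB F t x)).

Definition DS_admissible (B : bop E Em1) : Prop :=
  exists VB, [/\ is_VB B VB,
    forall F, sot_continuous_functions F -> sot_continuous_functions (VB F) &
    (space_opnorm t0 sot_continuous_functions VB < 1)%E].

(* Graph of (A_{-1} + B)_{|E} *)
Definition part_in_E (B : bop E Em1) (x y : E) : Prop :=
  exists2 v, generator Tm1 (j x) v & v + B x = j y.

Local Notation LE := (bop E E).
Local Notation LEm1 := (bop E Em1).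

(* U_{-1}(t), whose generator is G_{-1}, and the inclusion of L(E) in
   L(E, E_{-1}) *)
Definition Um1 (t : R) : bop LEm1 LEm1 := lmul E (Tm1 t).
Definition jL : bop LE LEm1 := lmul E j.

Definition frakX : set (R -> bop LE LE) :=
  [set F : R -> bop LE LE | [/\ exists M : R, forall t, 0 <= t <= t0 -> rnorm (F t) <= M,
    forall C, {within `[0, t0], continuous ((fun t => F t C) : R -> sot E E)} &
    bi_equicontinuous (F @` `[0, t0])]].

Definition is_VK (K : bop LE LEm1)
    (VK : (R -> bop LE LE) -> (R -> bop LE LE)) : Prop :=
  forall F, frakX F -> forall t C, 0 <= t <= t0 ->
    is_sot_riemann_integral (fun r => Um1 (t - r) (K (F r C))) 0 t
      (jL (VK F t C)).

Definition sot_DS_admissible (K : bop LE LEm1) : Prop :=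
  continuous (K : sot E E -> sot E Em1) /\
  exists VK, [/\ is_VK K VK,
    forall F, frakX F -> frakX (VK F) &
    (space_opnorm t0 frakX VK < 1)%E].

(* Graph of (G_{-1} + K)_{|L(E)} *)
Definition part_in_LE (K : bop LE LEm1) (C D : LE) : Prop :=
  exists2 G, sot_generator Um1 (jL C) G & G + K C = jL D.

End extrapolation.

(* Main.v *)
Require Import Defs.
From HB Require Import structures.
From mathcomp Require Import all_boot all_order all_algebra.
From mathcomp Require Import all_classical all_reals all_analysis.
From mathcomp Require Import complex ring lra.

Set Implicit Arguments.
Unset Strict Implicit.
Unset Printing Implicit Defensive.

Import Order.TTheory GRing.Theory Num.Theory.
Import numFieldNormedType.Exports.

Local Open Scope classical_set_scope.
Local Open Scope ring_scope.

(** Left multiplication [B |-> lmul E B] is the bridge between the two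
    conditions: the operators K of (i) are exactly the left multiplications by
    the operators B of (ii), and B is recovered as K applied to the identity.

    From K to B, the point is that K has to be a left multiplication.  As V acts
    by composition with S, its generator acts pointwise
    ([sot_generator_pointwiseP]), so (C, D) in the graph of the generator gives
    (CQ, DQ) in the graph for every Q.  There K is the difference of two
    operators that commute with right multiplication, hence K(CQ) = (KC)Q.  The
    means C of S over shorter and shorter intervals have their range in the
    domain of the generator of S and tend strongly to the identity
    ([semigroup_mean]); as K is continuous for the strong topologies, the
    identity passes to the limit and K(Q) = K(I)Q
    ([perturbation_left_multiplication]).

    For K = lmul B the two generation conditions are equivalent: both sides of
    the first are pointwise in C and D, and conversely x and y are recovered
    from the operators of rank one with range spanned by x and y
    ([generator_transferP]).

    For K = lmul B the two admissibility conditions are also equivalent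
    ([sot_DS_admissible_lmul]).  One direction feeds V_K with the functions
    r |-> lmul (G r) and evaluates at the identity.  In the other,
    (V_K F)(t)C = V_B(F(.)C)(t), and the delicate point is bi-equicontinuity,
    which needs control of V_B G at a single vector.  It comes from
    [VB_pointwise_bound]: composing G with an operator of rank one with range
    spanned by x turns the bound on V_B for the sup norm into
    |(V_B G)(t)x| <= q sup_r |G(r)x|.  This uses a norming functional, that is,
    the Hahn-Banach theorem.

    The values of V_B are only known through the embedding j in the
    extrapolation space, whose injectivity amounts to the surjectivity of the
    generator A of T.  The negative growth bound gives some h with |T(h)| < 1,
    hence T(h) - I is onto, and the mean of T over [0, h] maps a preimage of h y
    to a preimage of y under A ([generator_surjective]). *)

(** * Real-valued norms and bounded operators *)

Section rnorm_theory.
Variables (R : realType) (k : scalar_kind).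
Local Notation K := (scalars R k).

Lemma ltr_ofR (r s : R) : (ofR k r < ofR k s) = (r < s).
Proof. by case: k => //; rewrite /ofR ltcR. Qed.

Lemma ofRN (r : R) : ofR k (- r) = - ofR k r.
Proof. by case: k => //; rewrite /ofR rmorphN. Qed.

Lemma ofRB (r s : R) : ofR k (r - s) = ofR k r - ofR k s.
Proof. by rewrite ofRD ofRN. Qed.

Lemma norm_ofR (r : R) : `|ofR k r| = ofR k `|r|.
Proof. by case: k => //; rewrite /ofR normc_def /= expr0n/= addr0 sqrtr_sqr. Qed.

Variable E : normedModType K.
Implicit Types (x y z : E) (r s c : R).

Lemma rnorm0 : rnorm (0 : E) = 0.
Proof. by rewrite /rnorm normr0 -(ofR0 R k) ofRK. Qed.

Lemma rnormN x : rnorm (- x) = rnorm x.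
Proof. by rewrite /rnorm normrN. Qed.

Lemma rnormBC x y : rnorm (x - y) = rnorm (y - x).
Proof. by rewrite /rnorm distrC. Qed.

Lemma ler_rnormD x y : rnorm (x + y) <= rnorm x + rnorm y.
Proof. by rewrite -(ler_ofR k) ofRD !rnormE ler_normD. Qed.

Lemma ler_rnormB x y : rnorm (x - y) <= rnorm x + rnorm y.
Proof. by rewrite (le_trans (ler_rnormD _ _))// rnormN. Qed.

Lemma rnormZ (a : K) x : rnorm (a *: x) = toR `|a| * rnorm x.
Proof.
by rewrite /rnorm normrZ -{1}toR_norm -{1}rnormE -ofRM ofRK.
Qed.

Lemma rnormZr r x : rnorm (ofR k r *: x) = `|r| * rnorm x.
Proof. by rewrite rnormZ norm_ofR ofRK. Qed.

Lemma rnorm_eq0 x : (rnorm x == 0) = (x == 0).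
Proof.
apply/eqP/eqP => [x0|->]; last exact: rnorm0.
by apply/eqP; rewrite -normr_eq0 -rnormE x0 ofR0.
Qed.

Lemma cvg_rnormP (T : Type) (Phi : set_system T) (f : T -> E) l :
  Filter Phi ->
  (f x @[x --> Phi] --> l) <->
  (forall e, 0 < e -> \forall x \near Phi, rnorm (f x - l) < e).
Proof.
move=> FPhi; split=> [/cvgrPdistC_lt fl e e0|fl].
  have /fl : 0 < ofR k e by rewrite -(ofR0 R k) ltr_ofR.
  by apply: filterS => x /=; rewrite -rnormE ltr_ofR.
apply/cvgrPdistC_lt => e e0.
have eE : ofR k (toR e) = e by rewrite toR_ge0// ltW.
have /fl : 0 < toR e by rewrite -(ltr_ofR) ofR0 eE.
by apply: filterS => x /=; rewrite -(ltr_ofR) eE rnormE.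
Qed.

Lemma rnorm_cvg (T : Type) (Phi : set_system T) (f : T -> E) l :
  Filter Phi ->
  f x @[x --> Phi] --> l -> rnorm (f x) @[x --> Phi] --> rnorm l.
Proof.
move=> FPhi /cvg_rnormP fl; apply/cvgrPdistC_lt => e /fl; apply: filterS => x /=.
apply: le_lt_trans; rewrite ler_norml; apply/andP; split.
  rewrite lerNl opprB lerBlDr rnormBC.
  by have := ler_rnormD (l - f x) (f x); rewrite subrK.
by rewrite lerBlDr; have := ler_rnormD (f x - l) l; rewrite subrK.
Qed.

End rnorm_theory.

Lemma rnorm_cauchy_cvg (R : realType) (k : scalar_kind)
    (E : completeNormedModType (scalars R k)) (u : nat -> E) :
  (forall e : R, 0 < e ->
    exists N, forall m, rnorm (u (N + m)%N - u N) <= e) ->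
  cvg (u @ \oo).
Proof.
move=> uC; apply/cauchy_cvgP/cauchyP => e e0.
have eE : ofR k (toR e) = e by rewrite toR_ge0// ltW.
have e'0 : 0 < toR e / 2 by rewrite divr_gt0// -(ltr_ofR k) ofR0 eE.
have [N uN] := uC _ e'0; exists (u N).
exists N => // n /= Nn; rewrite -ball_normE /= distrC -rnormE -eE ltr_ofR.
rewrite -(subnKC Nn); apply: (le_lt_trans (uN _)).
by rewrite ltr_pdivrMr// ltr_pMr ?ltr1n// -(ltr_ofR k) ofR0 eE.
Qed.

Section bop_theory.
Variables (R : realType) (k : scalar_kind).
Local Notation K := (scalars R k).
Variables E F : normedModType K.

Lemma bopD (f : bop E F) x y : f (x + y) = f x + f y.
Proof. exact: linearD. Qed.

Lemma bopB (f : bop E F) x y : f (x - y) = f x - f y.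
Proof. exact: linearB. Qed.

Lemma bopZ (f : bop E F) a x : f (a *: x) = a *: f x.
Proof. exact: linearZZ. Qed.

Lemma bop0 (f : bop E F) : f 0 = 0.
Proof. exact: linear0. Qed.

Lemma rnorm_bop (f : bop E F) : rnorm f = opnorm f.
Proof. by rewrite /rnorm -[`|f|]/(ofR k (opnorm f)) ofRK. Qed.

Lemma ler_rnorm_bop (f : bop E F) (x : E) : rnorm (f x) <= rnorm f * rnorm x.
Proof. by rewrite rnorm_bop -(ler_ofR k) ofRM !rnormE ler_opnorm. Qed.

Lemma rnorm_bop_le (f : bop E F) (c : R) : 0 <= c ->
  (forall x, rnorm (f x) <= c * rnorm x) -> rnorm f <= c.
Proof.
move=> c0 fc; rewrite rnorm_bop; apply: opnorm_le => x x1.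
by rewrite (le_trans (fc x))// ler_piMr.
Qed.

Lemma bounded_linear_rnorm (f : E -> F) (c : R) :
  linear f -> (forall x, rnorm (f x) <= c * rnorm x) ->
  f \in bounded_linear E F.
Proof.
move=> lf fc; rewrite inE; split=> //; exists c => x.
by rewrite -!rnormE -ofRM ler_ofR.
Qed.

Lemma bop_cvg (f : bop E F) (T : Type) (Phi : set_system T) (u : T -> E) l :
  Filter Phi -> u x @[x --> Phi] --> l -> f (u x) @[x --> Phi] --> f l.
Proof.
move=> FPhi /cvg_rnormP ul; apply/cvg_rnormP => e e0.
have f1 : 0 < rnorm f + 1 by rewrite ltr_wpDl// rnorm_ge0.
have /ul : 0 < e / (rnorm f + 1) by rewrite divr_gt0.
apply: filterS => x; rewrite ltr_pdivlMr// => xe.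
rewrite -linearB (le_lt_trans (ler_rnorm_bop _ _))//.
by rewrite (le_lt_trans _ xe)// mulrC ler_wpM2l ?rnorm_ge0// lerDl.
Qed.

End bop_theory.

(** * Uniform boundedness over real or complex scalars *)

Section realification.
Variables (R : realType) (k : scalar_kind).
Local Notation K := (scalars R k).

(** The same space and the same norm with scalars restricted to the reals, so
    that theorems about real Banach spaces apply to complex ones. *)
Definition realified (E : normedModType K) : Type := E.

Section lmodule.
Variable E : normedModType K.
HB.instance Definition _ := GRing.Zmodule.copy (realified E) E.
HB.instance Definition _ := Choice.copy (realified E) E.

Let scale (r : R) (x : realified E) : realified E := ofR k r *: (x : E).

Let scaleA r s x : scale r (scale s x) = scale (r * s) x.
Proof. by rewrite /scale scalerA ofRM. Qed.

Let scale1 : left_id 1 scale.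
Proof. by move=> x; rewrite /scale ofR1 scale1r. Qed.

Let scaleDr : right_distributive scale +%R.
Proof. by move=> r x y; rewrite /scale scalerDr. Qed.

Let scaleDl x : {morph scale^~ x : r s / r + s}.
Proof. by move=> r s; rewrite /scale ofRD scalerDl. Qed.

HB.instance Definition _ := GRing.Zmodule_isLmodule.Build R (realified E)
  scaleA scale1 scaleDr scaleDl.

Let norm (x : realified E) : R := rnorm (x : E).

Let ler_norm_add x y : norm (x + y) <= norm x + norm y.
Proof. exact: ler_rnormD. Qed.

Let norm_scale r x : norm (r *: x) = `|r| * norm x.
Proof. exact: rnormZr. Qed.

Let norm_eq0 x : norm x = 0 -> x = 0.
Proof. by move=> /eqP; rewrite rnorm_eq0 => /eqP. Qed.

HB.instance Definition _ := Lmodule_isNormed.Build R (realified E)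
  ler_norm_add norm_scale norm_eq0.

End lmodule.

Section complete.
Variable E : completeNormedModType K.

Let realified_complete (F : set_system (realified E)) :
  ProperFilter F -> cauchy F -> cvg F.
Proof.
move=> FF /cauchyP FC.
have : cauchy (F : set_system E).
  apply/cauchyP => e e0.
  have eE : ofR k (toR e) = e by rewrite toR_ge0// ltW.
  have /FC[x xF] : 0 < toR e by rewrite -(ltr_ofR k) ofR0 eE.
  exists x; apply: filterS xF => y; rewrite -!ball_normE /=.
  by rewrite -rnormE -(ltr_ofR k) eE.
move=> /(@cauchy_cvg E F FF)/cvg_ex[l Fl].
apply/cvg_ex; exists (l : realified E).
apply/fcvgrPdist_lt => e e0.
have : 0 < ofR k e by rewrite -(ofR0 R k) ltr_ofR.
move/fcvgrPdist_lt : Fl => /[apply]; apply: filterS => x.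
by rewrite -rnormE ltr_ofR.
Qed.

HB.instance Definition _ :=
  Uniform_isComplete.Build (realified E) realified_complete.
End complete.
End realification.

(** Boundedness of a family of operators does not depend on the scalars, so this
    is the Banach-Steinhaus theorem for the underlying real spaces. *)
Lemma uniform_boundedness (R : realType) (k : scalar_kind)
    (E : completeNormedModType (scalars R k)) (F : normedModType (scalars R k))
    (S : set (bop E F)) :
  (forall x, exists M, forall f, S f -> rnorm (f x) <= M) ->
  exists M, forall f, S f -> rnorm f <= M.
Proof.
move=> Sb.
pose S' : set (realified E -> realified F) :=
  [set (fun x => f x) | f in S].
have [] := @Banach_Steinhauss R (realified E) (realified F) S' _ _ 1.
- move=> _ [f Sf <-]; split.
    move=> r; exists (rnorm f * r) => x xr.
    by rewrite (le_trans (ler_rnorm_bop f x))// ler_wpM2l// rnorm_ge0.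
  by move=> r x y; exact: (bop_linear f).
- by move=> x; have [M SM] := Sb x; exists M => _ [f Sf <-]; exact: SM.
move=> M SM; exists M => f Sf; rewrite rnorm_bop; apply: opnorm_le => x x1.
by apply: (SM (fun x => f x)) => //; exists f.
Qed.

(** * Norming functionals and operators of rank one *)

Section hahn_banach.
Variables (R : realType) (V : normedModType R) (e : V).
Hypothesis e1 : `|e| = 1.

(** Partial functionals are represented by their graphs.  Domination by the
    norm forces a linear graph to be single-valued. *)
Let linear_graph (G : set (V * R)) : Prop :=
  forall (a : R) p q, G p -> G q -> G (a *: p.1 + q.1, a * p.2 + q.2).

Let dominated (G : set (V * R)) : Prop := forall p, G p -> p.2 <= `|p.1|.

(** Graphs are joined to the line through (e, 1) rather than required to contain
    it: with this choice the empty chain also has an upper bound. *)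
Let line : set (V * R) := [set (a *: e, a) | a in [set: R]].

Let graph G := linear_graph (G `|` line) /\ dominated (G `|` line).

Let line_linear (a : R) p q :
  line p -> line q -> line (a *: p.1 + q.1, a * p.2 + q.2).
Proof.
by move=> [r _ <-] [s _ <-]; exists (a * r + s) => //=; rewrite scalerDl scalerA.
Qed.

Let graph_bigcup (F : set (set (V * R))) : F `<=` graph -> total_on F subset ->
  graph (\bigcup_(X in F) X).
Proof.
move=> FG Ft; split.
  move=> a p q [[X FX Xp]|lp] [[Y FY Yq]|lq].
  - have [XY|YX] := Ft _ _ FX FY.
      have [] := (FG _ FY).1 a p q (or_introl (XY _ Xp)) (or_introl Yq).
        by left; exists Y.
      by right.
    have [] := (FG _ FX).1 a p q (or_introl Xp) (or_introl (YX _ Yq)).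
      by left; exists X.
    by right.
  - have [] := (FG _ FX).1 a p q (or_introl Xp) (or_intror lq).
      by left; exists X.
    by right.
  - have [] := (FG _ FY).1 a p q (or_intror lp) (or_introl Yq).
      by left; exists Y.
    by right.
  - by right; exact: line_linear.
move=> p [[X FX Xp]|[a _ <-]/=]; first exact: ((FG _ FX).2 p (or_introl Xp)).
by rewrite normrZ e1 mulr1 ler_norm.
Qed.

Let graph0 H p : linear_graph H -> H p -> H (0, 0).
Proof.
by move=> Hl Hp; have := Hl (-1) p p Hp Hp; rewrite !(scaleN1r, mulN1r) !addNr.
Qed.

(** One-dimensional extension: the value c at x has to lie between all
    s - |y - x| and all |y + x| - s for (y, s) in H, and these bounds are
    consistent because H is dominated by the norm. *)
Let extend (H : set (V * R)) (x : V) : linear_graph H -> dominated H ->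
  H (0, 0) ->
  exists c, dominated [set (p.1 + t *: x, p.2 + t * c) | p in H & t in [set: R]].
Proof.
move=> Hl Hd H0.
have HZ a p : H p -> H (a *: p.1, a * p.2).
  by move=> Hp; have := Hl a p _ Hp H0; rewrite !addr0.
have HD p q : H p -> H q -> H (p.1 + q.1, p.2 + q.2).
  by move=> Hp Hq; have := Hl 1 p q Hp Hq; rewrite scale1r mul1r.
have normK (t : R) (v w : V) : 0 < t -> t * `|t^-1 *: v + w| = `|v + t *: w|.
  move=> t0; have -> : v + t *: w = t *: (t^-1 *: v + w).
    by rewrite scalerDr scalerA divff ?gt_eqF// scale1r.
  by rewrite normrZ gtr0_norm.
pose A := [set p.2 - `|p.1 - x| | p in H].
have Aub p : H p -> ubound A (`|p.1 + x| - p.2).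
  move=> Hp _ [q Hq <-]; rewrite lerBrDr addrAC lerBlDr.
  rewrite (le_trans (Hd _ (HD _ _ Hq Hp)))//=.
  rewrite [leRHS]addrC -[q.1 + p.1](_ : q.1 - x + (p.1 + x) = _) ?ler_normD//.
  by rewrite addrACA [- x + _]addrC subrr addr0.
have Anonempty : A !=set0 by exists (0 - `|0 - x|), (0, 0).
have supA : has_sup A by split=> //; exists (`|0 + x| - 0); exact: (Aub (0, 0)).
exists (sup A) => _ [p Hp [t _ <-]] /=.
have cl q : H q -> q.2 - `|q.1 - x| <= sup A.
  by move=> Hq; apply: sup_upper_bound => //; exists q.
have cu q : H q -> sup A <= `|q.1 + x| - q.2.
  by move=> Hq; apply: ge_sup => //; exact: Aub.
have [t0|t0|->] := ltrgt0P t.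
- have := cu _ (HZ t^-1 _ Hp); rewrite /= lerBrDr => /(ler_wpM2l (ltW t0)).
  by rewrite normK// mulrDr mulrA divff ?gt_eqF// mul1r addrC.
- have nt0 : 0 < - t by rewrite oppr_gt0.
  have := cl _ (HZ (- t)^-1 _ Hp); rewrite /= lerBlDr => /(ler_wpM2l (ltW nt0)).
  rewrite mulrDr normK// mulrA divff ?gt_eqF// mul1r.
  by rewrite scalerN scaleNr opprK mulNr addrC lerBrDr.
- by rewrite scale0r mul0r !addr0 Hd.
Qed.

Lemma hahn_banach_norming : exists f : V -> R,
  [/\ scalar f, forall x, f x <= `|x| & f e = 1].
Proof.
have [A [[Al Ad] Amax]] := Zorn_bigcup graph_bigcup.
pose H := A `|` line.
have He : H (e, 1) by right; exists 1; rewrite // scale1r.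
have H0 : H (0, 0) by exact: (graph0 Al He).
have Huniq x r s : H (x, r) -> H (x, s) -> r = s.
  have H_le a b : H (x, a) -> H (x, b) -> b <= a.
    move=> Ha Hb; have := Ad _ (Al (-1) _ _ Ha Hb).
    by rewrite /= scaleN1r addNr normr0 mulN1r addrC subr_le0.
  by move=> Hr Hs; apply/eqP; rewrite eq_le !H_le.
have Htotal x : exists r, H (x, r).
  apply: contrapT => /forallNP nHx.
  have [c Hc] := extend x Al Ad H0.
  set H' := (X in dominated X) in Hc.
  have HH' : H `<=` H'.
    move=> p Hp; exists p => //; exists 0 => //.
    by rewrite scale0r mul0r !addr0 -surjective_pairing.
  have lineH' : line `<=` H' by move=> p lp; apply: HH'; right.
  apply: (Amax H').
    split=> [p Ap|/(_ (x, c)) nA]; first by apply: HH'; left.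
    apply: (nHx c); left; apply: nA; exists (0, 0) => //; exists 1 => //=.
    by rewrite scale1r mul1r !add0r.
  rewrite /graph (setUidl lineH'); split=> // a p q.
  move=> [p' Hp' [t _ <-]] [q' Hq' [s _ <-]] /=.
  exists (a *: p'.1 + q'.1, a * p'.2 + q'.2); first exact: Al.
  exists (a * t + s) => //=; congr (_, _).
    by rewrite scalerDr scalerDl scalerA addrACA.
  by rewrite mulrDr mulrDl mulrA addrACA.
have [f Hf] := choice Htotal.
exists f; split.
- move=> a x y; apply: (Huniq (a *: x + y)) => //.
  exact: (Al a (x, f x) (y, f y) (Hf x) (Hf y)).
- by move=> x; exact: (Ad (x, f x) (Hf x)).
- exact: (Huniq e _ _ (Hf e) He).
Qed.

End hahn_banach.

(** Over the complex numbers, the complex-linear functional with real part f is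
    x |-> f x - i f (i x); rotating x so that its value becomes nonnegative shows
    that it obeys the same bound as f. *)
Lemma norming_functional (R : realType) (k : scalar_kind)
    (E : normedModType (scalars R k)) (x0 : E) : x0 != 0 ->
  exists (phi : E -> scalars R k) (e : E),
    [/\ scalar phi, forall x, `|phi x| <= `|x|, `|e| = 1 & phi e = 1].
Proof.
move=> x00; pose e := ofR k (rnorm x0)^-1 *: x0.
have nx0 : 0 < rnorm x0 by rewrite lt_def rnorm_eq0 x00 rnorm_ge0.
have e1 : rnorm e = 1.
  by rewrite rnormZr gtr0_norm ?invr_gt0// mulVf ?gt_eqF.
have [f [fl fle fe]] := @hahn_banach_norming R (realified E) e e1.
have {}fl (r : R) (x y : E) : f (ofR k r *: x + y) = r * f x + f y.
  exact: fl.
have {}fle (x : E) : f x <= rnorm x by exact: fle.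
have f0 : f 0 = 0.
  by have := fl (-1) 0 0; rewrite scaler0 addr0 mulN1r addNr.
have fD x y : f (x + y) = f x + f y.
  by have := fl 1 x y; rewrite ofR1 scale1r mul1r.
have fZ r x : f (ofR k r *: x) = r * f x.
  by have := fl r x 0; rewrite f0 !addr0.
clear fl; move: e e1 fe.
case: k E f x0 x00 nx0 fle f0 fD fZ => E f _ _ _ fle _ fD fZ e e1 fe.
  exists f, e; split=> //.
  - by move=> a x y; rewrite fD fZ.
  - move=> x; rewrite ler_norml fle andbT lerNl.
    by have := fle (- x); rewrite rnormN -scaleN1r (fZ (-1)) mulN1r.
have f_i x : f ('i%C *: ('i%C *: x)) = - f x.
  by rewrite scalerA -expr2 sqr_i (_ : -1 = ofR ComplexScalars (-1 : R)) ?fZ ?mulN1r// ofRN ofR1.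
pose phi (x : E) : R[i] := (f x +i* - f ('i%C *: x))%C.
have phil : scalar phi.
  move=> [a b] x y.
  have -> : (a +i* b)%C *: x = ofR ComplexScalars a *: x + ofR ComplexScalars b *: ('i%C *: x) :> E.
    rewrite scalerA -scalerDl; congr (_ *: _).
    by rewrite /ofR; simpc.
  rewrite /phi; apply/eqP; rewrite eq_complex /=; apply/andP; split; apply/eqP.
    by rewrite !(fD, fZ) mulrN opprK.
  have iZ r z : 'i%C *: (ofR ComplexScalars r *: z) =
      ofR ComplexScalars r *: ('i%C *: z) :> E.
    by rewrite scalerA mulrC -scalerA.
  by rewrite !(scalerDr, iZ, fD, fZ, f_i); ring.
have phi_le (x : E) : `|phi x| <= `|x|.
  have [->|z0] := eqVneq (phi x) 0; first by rewrite normr0.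
  set z := phi x in z0 *.
  pose u := `|z| / z.
  have u1 : `|u| = 1 by rewrite normrM normfV normr_id mulfV// normr_eq0.
  have phiu : phi (u *: x) = `|z|.
    have phi0 : phi 0 = 0 by have := phil (-1) 0 0; rewrite scaler0 addr0 mulN1r addNr.
    by have := phil u x 0; rewrite !addr0 phi0 addr0 => ->; rewrite /u divfK.
  have := fle (u *: x); rewrite rnormZ u1 -(ofR1 R ComplexScalars) ofRK mul1r.
  have -> : f (u *: x) = @toR R ComplexScalars (phi (u *: x)) by [].
  by rewrite phiu -(ler_ofR ComplexScalars) toR_norm rnormE.
have norm_e : `|e| = 1 by rewrite -rnormE e1 ofR1.
suff phi_e : phi e = 1 by exists phi, e.
apply/eqP; rewrite eq_complex /= fe eqxx /=.
pose b := - f ('i%C *: e).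
have : ofR ComplexScalars (Num.sqrt (1 ^+ 2 + b ^+ 2)) <= ofR ComplexScalars 1.
  by have := phi_le e; rewrite norm_e normc_def /= fe ofR1.
rewrite ler_ofR -{2}sqrtr1 ler_sqrt// expr1n gerDl => b0.
by rewrite -sqrf_eq0 eq_le sqr_ge0 andbT.
Qed.

Section rank_one.
Variables (R : realType) (k : scalar_kind).
Local Notation K := (scalars R k).
Variables (E : normedModType K) (phi : E -> K).
Hypotheses (phil : scalar phi) (phi_le : forall x, `|phi x| <= `|x|).

Lemma rank_one_subproof (F : normedModType K) (y : F) :
  (fun x => phi x *: y) \in bounded_linear E F.
Proof.
apply: (@bounded_linear_rnorm _ _ _ _ _ (rnorm y)) => [a x z|x].
  by rewrite phil scalerDl scalerA.
rewrite rnormZ mulrC ler_wpM2l ?rnorm_ge0//.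
by rewrite -(ler_ofR k) toR_norm rnormE.
Qed.

Definition rank_one (F : normedModType K) (y : F) : bop E F :=
  Bop (rank_one_subproof y).

End rank_one.

(** * Strong continuity *)

Section continuity.
Variables (R : realType) (k : scalar_kind).
Local Notation K := (scalars R k).

Lemma rnorm_cvg_le (E : normedModType K) (T : Type) (Phi : set_system T)
    (f : T -> E) (l : E) (c : R) {FPhi : ProperFilter Phi} :
  f x @[x --> Phi] --> l -> (\forall x \near Phi, rnorm (f x) <= c) ->
  rnorm l <= c.
Proof.
move=> /cvg_rnormP fl fc; apply/ler_addgt0Pr => e e0.
have [x [xe xc]] := filter_ex (filterI (fl _ e0) fc).
rewrite -[l](subKr (f x)) (le_trans (ler_rnormB _ _))// lerD//.
exact: ltW.
Qed.

Lemma near_right0P (P : R -> Prop) :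
  (\forall t \near 0^'+, P t) <->
  exists2 d : R, 0 < d & forall t, 0 < t -> t < d -> P t.
Proof.
split=> [/nbhs_ballP[d /= d0 dP]|[d d0 dP]].
  exists d => // t t0 td; apply: dP => //.
  by rewrite /ball/= sub0r normrN gtr0_norm.
apply/nbhs_ballP; exists d => //= t; rewrite /ball/= sub0r normrN => td t0.
by apply: dP => //; rewrite -[t]gtr0_norm.
Qed.

Lemma sot_within_continuousP (E F : normedModType K) (A : set R)
    (f : R -> bop E F) :
  {within A, continuous (f : R -> sot E F)} <->
  forall x, {within A, continuous (fun t => f t x)}.
Proof.
split=> [fc x t|fc t]; first exact: ((sot_cvgP _ _).1 (fc t) x).
by apply/sot_cvgP => x; exact: fc.
Qed.

Lemma within_continuous_rnormP (E : normedModType K) (A : set R) (f : R -> E) :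
  {within A, continuous f} <->
  forall t, A t -> forall e, 0 < e ->
    exists2 d : R, 0 < d &
      forall s, A s -> `|s - t| < d -> rnorm (f s - f t) < e.
Proof.
rewrite subspace_continuousP; split=> fc t At.
  move=> e e0; have /cvg_rnormP/(_ _ e0) := fc t At.
  rewrite near_withinE => /nbhs_ballP[d /= d0 dP]; exists d => // s As sd.
  by apply: dP => //; rewrite /ball/= distrC.
apply/cvg_rnormP => e e0; rewrite near_withinE; apply/nbhs_ballP.
have [d d0 dP] := fc t At e e0.
by exists d => //= s; rewrite /ball/= distrC => sd As; exact: dP.
Qed.

Lemma within_continuous_bounded (E : normedModType K) (a b : R) (f : R -> E) :
  {within `[a, b], continuous f} ->
  exists M, forall t, a <= t <= b -> rnorm (f t) <= M.
Proof.
move=> /subspace_continuousP fc.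
have nfc : {within `[a, b], continuous (fun t => rnorm (f t))}.
  by apply/subspace_continuousP => t tab; apply: rnorm_cvg; exact: fc.
have := compact_bounded (continuous_compact nfc (@segment_compact _ a b)).
move=> [M [_ MP]]; exists (M + 1) => t tab.
have /MP{}MP : M < M + 1 by rewrite ltrDl.
by rewrite (le_trans (ler_norm _))// MP//; exists t => //=; rewrite in_itv.
Qed.

(** Strongly continuous functions on a compact interval are pointwise bounded,
    hence norm bounded. *)
Lemma sot_within_continuous_bounded (E : completeNormedModType K)
    (F : normedModType K) (a b : R) (f : R -> bop E F) :
  {within `[a, b], continuous (f : R -> sot E F)} ->
  exists M, forall t, a <= t <= b -> rnorm (f t) <= M.
Proof.
move=> /sot_within_continuousP fc.
have [|M MP] := @uniform_boundedness _ _ _ _ (f @` `[a, b]).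
  move=> x; have [M MP] := within_continuous_bounded (fc x).
  by exists M => _ [t + <-]; rewrite /= in_itv => /MP.
by exists M => t tab; apply: MP; exists t => //=; rewrite in_itv.
Qed.

Lemma C0_semigroup_within (X : normedModType K) (W : R -> bop X X) (a b : R)
    (x : X) :
  C0_semigroup W -> 0 <= a -> {within `[a, b], continuous (fun t => W t x)}.
Proof.
move=> [_ Wc] a0; have /sot_within_continuousP/(_ x) := Wc.
apply: continuous_subspaceW => t /=.
by rewrite !in_itv/= andbT => /andP[/(le_trans a0)].
Qed.

End continuity.

(** * Means of a semigroup and its generator *)

Section semigroup_mean.
Variables (R : realType) (k : scalar_kind) (X : completeNormedModType (scalars R k)).
Variables (T : R -> bop X X) (hT : C0_semigroup T).
Implicit Types (d e r s t h : R) (x y z : X).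

Let T0 y : T 0 y = y. Proof. by rewrite hT.1.1. Qed.

Let TD s t y : 0 <= s -> 0 <= t -> T (s + t) y = T s (T t y).
Proof. by move=> s0 t0; rewrite hT.1.2. Qed.

Let Tcont t y e : 0 <= t -> 0 < e -> exists2 d : R, 0 < d &
  forall s, 0 <= s -> `|s - t| < d -> rnorm (T s y - T t y) < e.
Proof.
move=> t0 e0; have /sot_within_continuousP/(_ y) := hT.2.
move=> /within_continuous_rnormP/(_ t).
rewrite /= in_itv/= andbT => /(_ t0 e e0)[d d0 dP].
by exists d => // s s0; apply: dP; rewrite /= in_itv/= andbT.
Qed.

Let Tbounded h : exists2 M : R, 0 <= M & forall t, 0 <= t <= h -> rnorm (T t) <= M.
Proof.
have [|M MP] := @sot_within_continuous_bounded _ _ _ _ 0 h T.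
  apply: continuous_subspaceW hT.2 => t /=.
  by rewrite !in_itv/= andbT => /andP[].
exists `|M| => // t /MP tM; exact: (le_trans tM (ler_norm _)).
Qed.

(** The average of T(s) y over the grid of 2^m equidistant points of [0, d[
    starting at 0, that is, a Riemann sum of (1/d) times the integral of
    s |-> T(s) y over [0, d].  Halving the interval at each step makes the
    estimates below inductions on m. *)
Fixpoint mean_approx d m y : X :=
  if m is m'.+1 then
    ofR k 2^-1 *: (mean_approx (d / 2) m' y + T (d / 2) (mean_approx (d / 2) m' y))
  else y.

Let half2 (x : X) : ofR k 2^-1 *: (x + x) = x.
Proof.
by rewrite scalerDr -scalerDl -ofRD [_ + _](_ : _ = 1) ?ofR1 ?scale1r//; lra.
Qed.

Lemma mean_approx_linear d m : linear (mean_approx d m).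
Proof.
elim: m d => // m IH d a x y /=.
rewrite !IH linearP [in RHS]scalerA [a * _]mulrC -scalerA -scalerDr.
by congr (_ *: _); rewrite scalerDr addrACA.
Qed.

(** An average of vectors of a ball stays in the ball. *)
Lemma mean_approx_dist d m s y z e : 0 <= d -> 0 <= s ->
  (forall r, s <= r <= s + d -> rnorm (T r y - z) <= e) ->
  rnorm (T s (mean_approx d m y) - z) <= e.
Proof.
elim: m d s => [|m IH] d s d0 s0 Te /=.
  by apply: Te; rewrite lexx lerDl.
have d20 : 0 <= d / 2 by rewrite divr_ge0.
set u := mean_approx _ _ _.
rewrite -[z]half2 linearZ -scalerBr rnormZr (linearD (T s)) opprD addrACA /= -TD//.
rewrite gtr0_norm ?invr_gt0// ler_pdivrMl// [2 * e]mulrDl !mul1r.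
rewrite (le_trans (ler_rnormD _ _))// lerD//; apply: IH => //; rewrite ?addr_ge0//.
  move=> r /andP[sr rs]; apply: Te; rewrite sr/= (le_trans rs)// lerD2l.
  by rewrite ler_pdivrMr// ler_peMr// ler1n.
move=> r /andP[sr rs]; apply: Te; rewrite (le_trans _ sr) ?lerDl//=.
by rewrite (le_trans rs)// -addrA -splitr.
Qed.

Lemma mean_approx_add d n m y :
  mean_approx d (n + m) y = mean_approx d n (mean_approx (d / 2 ^+ n) m y).
Proof.
elim: n d => [|n IH] d /=; first by rewrite expr0 divr1.
by rewrite IH exprS invfM mulrA.
Qed.

Lemma mean_approx_bounded d m y M : 0 <= d ->
  (forall r, 0 <= r <= d -> rnorm (T r) <= M) ->
  rnorm (mean_approx d m y) <= M * rnorm y.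
Proof.
move=> d0 TM; rewrite -[mean_approx _ _ _]subr0 -[mean_approx _ _ _]T0.
apply: mean_approx_dist => // r; rewrite add0r subr0 => /TM rM.
by rewrite (le_trans (ler_rnorm_bop _ _))// ler_wpM2r// rnorm_ge0.
Qed.

(** The telescoping identity (T(d/N) - I) sum_(i < N) T(i d/N) = T(d) - I, for
    N = 2^n. *)
Lemma mean_approx_diff d n y : 0 <= d ->
  T (d / 2 ^+ n) (mean_approx d n y) - mean_approx d n y =
  ofR k (2 ^+ n)^-1 *: (T d y - y).
Proof.
elim: n d => [|n IH] d d0 /=.
  by rewrite expr0 divr1 invr1 ofR1 scale1r.
have d20 : 0 <= d / 2 by rewrite divr_ge0.
set u := mean_approx _ _ _.
have {IH} : T (d / 2 ^+ n.+1) u - u = ofR k (2 ^+ n)^-1 *: (T (d / 2) y - y).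
  by rewrite exprS invfM mulrA IH.
set t := d / _ => uE.
have t0 : 0 <= t by rewrite divr_ge0// exprn_ge0.
rewrite linearZ -scalerBr (linearD (T t)) /= opprD addrACA -TD// [t + _]addrC TD//.
rewrite -(linearB (T (d / 2))) uE linearZ -scalerDr linearB /= -TD// -splitr.
rewrite [X in _ *: (_ *: X)]addrC addrA subrK scalerA -ofRM -invfM.
by rewrite [2 ^+ n.+1]exprS.
Qed.

(** With u the average over the grid, sum the increments of T along the first i
    points: each is 2^-n (T(h) - I) T(r) y for some grid point r, which differs
    from 2^-n (T(h) - I) y by as little as T(r) y differs from y. *)
Lemma mean_approx_dist_mul h n i y e M : 0 <= h ->
  rnorm (T h) <= M ->
  (forall r, 0 <= r <= i%:R * (h / 2 ^+ n) -> rnorm (T r y - y) <= e) ->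
  rnorm (T (i%:R * (h / 2 ^+ n)) (mean_approx h n y) - mean_approx h n y
         - ofR k (i%:R / 2 ^+ n) *: (T h y - y)) <=
  i%:R / 2 ^+ n * ((M + 1) * e).
Proof.
move=> h0 hM; set d := h / _; set u := mean_approx _ _ _.
have d0 : 0 <= d by rewrite divr_ge0// exprn_ge0.
elim: i => [|i IH] Te.
  by rewrite !mul0r ofR0 scale0r T0 !subrr rnorm0.
have id0 : 0 <= i%:R * d by rewrite mulr_ge0.
have idS : i.+1%:R * d = i%:R * d + d by rewrite -natr1 mulrDl mul1r.
have idle : i%:R * d <= i.+1%:R * d by rewrite idS lerDl.
rewrite -[X in ofR k (X / _)]natr1 mulrDl mul1r ofRD scalerDl idS TD//.
set q := (2 ^+ n)^-1.
have -> : T (i%:R * d) (T d u) - u =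
    T (i%:R * d) u - u + ofR k q *: (T h (T (i%:R * d) y) - T (i%:R * d) y).
  rewrite -(TD y)// [h + _]addrC (TD y)// -bopB -bopZ -mean_approx_diff//.
  by rewrite bopB [RHS]addrC addrA subrK.
rewrite opprD addrACA -scalerBr (le_trans (ler_rnormD _ _))//.
have -> : i.+1%:R * q * ((M + 1) * e) =
    i%:R * q * ((M + 1) * e) + q * ((M + 1) * e) by rewrite -natr1; ring.
apply: lerD.
  by apply: IH => r /andP[r0 ri]; apply: Te; rewrite r0 (le_trans ri).
rewrite rnormZr ger0_norm ?invr_ge0 ?exprn_ge0// ler_wpM2l ?invr_ge0 ?exprn_ge0//.
rewrite opprB [y - _]addrC addrACA [- _ + y]addrC -bopB.
have ye : rnorm (T (i%:R * d) y - y) <= e by apply: Te; rewrite id0.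
rewrite (le_trans (ler_rnormD _ _))// mulrDl mul1r lerD//; last by rewrite rnormBC.
rewrite (le_trans (ler_rnorm_bop _ _))// ler_pM ?rnorm_ge0//.
Qed.

Let exists_half_pow h d : 0 < d -> exists n, h / 2 ^+ n < d.
Proof.
move=> d0; exists (Num.truncn (h / d)).+1.
rewrite ltr_pdivrMr ?exprn_gt0// mulrC -ltr_pdivrMr//.
rewrite (lt_trans (truncnS_gt _))// -natrX ltr_nat.
by rewrite ltn_expl.
Qed.

Let half_pow_cvg h : h / 2 ^+ n @[n --> \oo] --> (0 : R).
Proof.
apply/cvgrPdistC_lt => e e0; have [N hN] := exists_half_pow `|h| e0.
exists N => // n /= Nn; rewrite subr0 normrM normfV normrX.
rewrite [`|2|]ger0_norm// (le_lt_trans _ hN)// ler_wpM2l//.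
by rewrite lef_pV2 ?posrE ?exprn_gt0// ler_weXn2l ?ler1n.
Qed.

(** Refining the grid replaces y by an average of T(r) y over a single cell, so
    the averages form a Cauchy sequence. *)
Lemma mean_approx_cvg h y : 0 <= h -> cvg (mean_approx h n y @[n --> \oo]).
Proof.
move=> h0; have [M M0 TM] := Tbounded h.
apply: rnorm_cauchy_cvg => e e0.
have M1 : 0 < M + 1 by rewrite ltr_wpDl.
have [d d0 dP] := Tcont y (lexx 0) (divr_gt0 e0 M1).
have [N hN] := exists_half_pow h d0; exists N => m.
have hN0 : 0 <= h / 2 ^+ N by rewrite divr_ge0// exprn_ge0.
rewrite mean_approx_add.
set z := mean_approx (h / _) m y.
have -> : mean_approx h N z - mean_approx h N y = mean_approx h N (z - y).
  by have := mean_approx_linear h N (-1) y z; rewrite !scaleN1r addrC => <-; rewrite addrC.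
rewrite (le_trans (mean_approx_bounded _ _ h0 TM))//.
have : rnorm (z - y) <= e / (M + 1).
  rewrite -[z]T0; apply: mean_approx_dist => // r /andP[r0 rh].
  rewrite -[X in _ - X]T0; apply/ltW/dP => //.
  by rewrite subr0 ger0_norm// (le_lt_trans rh)// add0r.
rewrite ler_pdivlMr// mulrC; apply: le_trans.
by rewrite ler_wpM2r ?rnorm_ge0// lerDl.
Qed.

(** The limit C is y |-> (1/h) times the integral of T(s) y over [0, h].  Its
    range lies in the domain of the generator A, with A C = (T(h) - I)/h. *)
Lemma semigroup_mean h : 0 < h -> exists C : bop X X,
  (forall y, generator T (C y) (ofR k h^-1 *: (T h y - y))) /\
  (forall y e, (forall s, 0 <= s <= h -> rnorm (T s y - y) <= e) ->
    rnorm (C y - y) <= e).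
Proof.
move=> h0; have [M M0 TM] := Tbounded h.
pose c y := lim (mean_approx h n y @[n --> \oo]).
have cP y : mean_approx h n y @[n --> \oo] --> c y.
  exact: mean_approx_cvg (ltW h0).
have cl : linear c.
  move=> a x y; apply: (cvg_unique _ (cP (a *: x + y))) => //.
  have -> : (fun n => mean_approx h n (a *: x + y)) =
      (fun n => a *: mean_approx h n x + mean_approx h n y).
    by apply/funext => n; exact: mean_approx_linear.
  by apply: cvgD => //; apply: cvgZr.
have cb y : rnorm (c y) <= M * rnorm y.
  apply: (rnorm_cvg_le (cP y)); apply: nearW => n.
  exact: mean_approx_bounded (ltW h0) TM.
exists (Bop (bounded_linear_rnorm cl cb)); split=> /= [y|y e Te]; last first.
  have cy : mean_approx h n y - y @[n --> \oo] --> c y - y.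
    by apply: cvgB => //; exact: cvg_cst.
  apply: (rnorm_cvg_le cy); apply: nearW => n.
  rewrite -[mean_approx _ _ _]T0; apply: mean_approx_dist (ltW h0) (lexx 0) _ => r.
  by rewrite add0r; exact: Te.
have hM : rnorm (T h) <= M by apply: TM; rewrite lexx ltW.
have M1 : 0 < M + 1 by rewrite ltr_wpDl.
apply/cvg_rnormP => e e0; apply/near_right0P.
pose e' := h * (e / 2) / (M + 1).
have e'0 : 0 < e' by rewrite divr_gt0// mulr_gt0// divr_gt0.
have [d d0 dP] := Tcont y (lexx 0) e'0.
exists (Num.min d h) => [|t t0]; first by rewrite lt_min d0.
rewrite lt_min => /andP[td th].
have Te r : 0 <= r <= t -> rnorm (T r y - y) <= e'.
  move=> /andP[r0 rt]; rewrite -[X in _ - X]T0; apply/ltW/dP => //.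
  by rewrite subr0 ger0_norm// (le_lt_trans rt).
(* It suffices to bound the increment of T at c y, up to time t, by a multiple
   of t; this is the limit along the grid points q n * h below t of the bound
   for averages. *)
suff tle : rnorm (T t (c y) - c y - ofR k (t / h) *: (T h y - y)) <=
    t / h * ((M + 1) * e').
  have -> : ofR k t^-1 *: (T t (c y) - c y) - ofR k h^-1 *: (T h y - y) =
      ofR k t^-1 *: (T t (c y) - c y - ofR k (t / h) *: (T h y - y)).
    by rewrite [RHS]scalerBr [in RHS]scalerA -ofRM mulKf// gt_eqF.
  rewrite rnormZr gtr0_norm ?invr_gt0// ltr_pdivrMl// (le_lt_trans tle)//.
  have -> : (M + 1) * e' = h * (e / 2) by rewrite mulrC divfK ?gt_eqF.
  have -> : t / h * (h * (e / 2)) = t * (e / 2).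
    by rewrite [LHS]mulrA divfK ?gt_eqF.
  by rewrite ltr_pM2l// ltr_pdivrMr// ltr_pMr// ltr1n.
pose i n := Num.truncn (t / (h / 2 ^+ n)); pose q n := (i n)%:R / 2 ^+ n : R.
have d_gt0 n : 0 < h / 2 ^+ n by rewrite divr_gt0// exprn_gt0.
have qhE n : q n * h = (i n)%:R * (h / 2 ^+ n) by rewrite mulrAC -mulrA.
have /all_and2[qh_le qh_gt] n : q n * h <= t /\ t - h / 2 ^+ n <= q n * h.
  have := truncn_itv (divr_ge0 (ltW t0) (ltW (d_gt0 n))).
  rewrite qhE -/(i n) ler_pdivlMr// ltr_pdivrMr// => /andP[-> ti]; split=> //.
  by rewrite lerBlDr (le_trans (ltW ti))// -natr1 mulrDl mul1r.
have qh_cvg : q n * h @[n --> \oo] --> t.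
  apply/cvgrPdistC_lt => r r0.
  have /cvgrPdistC_lt/(_ r r0) := half_pow_cvg h.
  apply: filterS => n; rewrite subr0 gtr0_norm//; apply: le_lt_trans.
  rewrite distrC ger0_norm ?subr_ge0//.
  by rewrite lerBlDr -lerBlDl.
have qh0 n : 0 <= q n * h by rewrite qhE mulr_ge0// ltW.
have q0 n : 0 <= q n by rewrite divr_ge0// exprn_ge0.
pose u n := mean_approx h n y.
pose v n := T (q n * h) (u n) - u n - ofR k (q n) *: (T h y - y).
have vle n : rnorm (v n) <= t / h * ((M + 1) * e').
  rewrite /v qhE; apply: (le_trans (mean_approx_dist_mul (ltW h0) hM (e := e') _)).
    by move=> r; rewrite -qhE => /andP[r0 /le_trans rq]; apply: Te; rewrite r0 rq.
  have qt : (i n)%:R / 2 ^+ n <= t / h by rewrite ler_pdivlMr; [exact: qh_le|].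
  by rewrite ler_wpM2r// mulr_ge0 ?ltW.
suff vcvg : v n @[n --> \oo] --> T t (c y) - c y - ofR k (t / h) *: (T h y - y).
  by apply: (rnorm_cvg_le vcvg); apply: nearW.
have q_cvg : ofR k (q n) *: (T h y - y) @[n --> \oo] -->
    ofR k (t / h) *: (T h y - y).
  apply/cvg_rnormP => r r0.
  have N0 : 0 < h * r / (rnorm (T h y - y) + 1).
    by rewrite divr_gt0 ?mulr_gt0// ltr_wpDl// rnorm_ge0.
  have /cvgrPdistC_lt/(_ _ N0) := qh_cvg; apply: filterS => n.
  rewrite ltr_pdivlMr ?ltr_wpDl ?rnorm_ge0// => qt.
  rewrite -scalerBl -ofRB rnormZr -[q n](mulfK (lt0r_neq0 h0)) -mulrBl normrM.
  rewrite mulrAC normfV [`|h|]gtr0_norm// ltr_pdivrMr// [r * h]mulrC.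
  by rewrite (le_lt_trans _ qt)// ler_wpM2l// lerDl.
apply: cvgB => //.
apply: cvgB; last exact: cP.
apply/cvg_rnormP => r r0.
have r20 : 0 < r / 2 by rewrite divr_gt0.
have [d' d'0 d'P] := Tcont (c y) (ltW t0) r20.
have /cvgrPdistC_lt/(_ d' d'0) qd' := qh_cvg.
have /cvg_rnormP/(_ _ (divr_gt0 r20 M1)) uc := cP y.
near=> n.
have -> : T (q n * h) (u n) - T t (c y) =
    T (q n * h) (u n - c y) + (T (q n * h) (c y) - T t (c y)).
  by rewrite bopB addrA subrK.
rewrite (le_lt_trans (ler_rnormD _ _))// [r]splitr ltr_leD//; last first.
  by apply/ltW/d'P => //; near: n.
have : rnorm (u n - c y) < r / 2 / (M + 1) by near: n.
rewrite ltr_pdivlMr// mulrC; apply: le_lt_trans.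
rewrite (le_trans (ler_rnorm_bop _ _))// ler_wpM2r ?rnorm_ge0//.
rewrite (le_trans (TM _ _)) ?lerDl// qh0 (le_trans (qh_le n))// ltW.
Unshelve. all: by end_near.
Qed.

End semigroup_mean.

Section generator.
Variables (R : realType) (k : scalar_kind).
Local Notation K := (scalars R k).

Lemma generatorZ (X : normedModType K) (T : R -> bop X X) (a : K) (x y : X) :
  generator T x y -> generator T (a *: x) (a *: y).
Proof.
move=> Txy; rewrite /generator.
have -> : (fun t => ofR k t^-1 *: (T t (a *: x) - a *: x)) =
    (fun t => a *: (ofR k t^-1 *: (T t x - x))).
  by apply/funext => t; rewrite bopZ -scalerBr !scalerA mulrC.
exact: cvgZr.
Qed.

Lemma generator_unique (X : normedModType K) (T : R -> bop X X) (x y z : X) :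
  generator T x y -> generator T x z -> y = z.
Proof. by move=> Txy Txz; exact: (cvg_unique _ Txy Txz). Qed.

Variable X : completeNormedModType K.
Variables (T : R -> bop X X) (hT : C0_semigroup T).
Hypothesis hT0 : (growth_bound T < 0)%E.

Lemma growth_bound_lt0_contractive : exists2 h, 0 < h & rnorm (T h) < 1.
Proof.
have [_ [w [M M1 wM] <-]] := ereal_inf_lt hT0.
rewrite lte_fin => w0.
have M0 : 0 < M by exact: lt_le_trans M1.
pose h := (1 + ln M) / - w.
have h0 : 0 < h by rewrite divr_gt0 ?oppr_gt0// ltr_wpDr// ln_ge0.
exists h => //; rewrite (le_lt_trans (wM _ (ltW h0)))//.
have -> : w * h = - 1 - ln M.
  by rewrite /h invrN !mulrN mulrCA divff ?lt_eqF// mulr1 opprD.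
by rewrite expRD expRN lnK ?posrE// mulrCA divff ?gt_eqF// mulr1.
Qed.

(** If T(h) z - z = h y, then the mean of z over [0, h] is a preimage of y under
    the generator; such a z is the fixed point of the contraction
    z |-> T(h) z - h y. *)
Lemma generator_surjective (y : X) : exists x, generator T x y.
Proof.
have [h h0 Th1] := growth_bound_lt0_contractive.
have [C [CT _]] := semigroup_mean hT h0.
suff [z zE] : exists z : X, T h z - z = ofR k h *: y.
  exists (C z); have := CT z; rewrite zE scalerA -ofRM mulVf ?gt_eqF//.
  by rewrite ofR1 scale1r.
pose f (z : realified X) : realified X := T h z - ofR k h *: y.
have [|||z _ zE] := @banach_fixed_point R (realified X) setT
  (HB.pack f (isFun.Build _ _ setT setT f (fun _ _ => I))).
- exists (NngNum (rnorm_ge0 (T h))); split=> // -[x z] /= _.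
  rewrite [leLHS](_ : _ = rnorm (f x - f z))//.
  rewrite [leRHS](_ : _ = rnorm (T h) * rnorm (x - z :> X))//.
  rewrite /f opprB addrA subrK -bopB; exact: ler_rnorm_bop.
- exact: closedT.
- by exists 0.
- exists z; by rewrite {2}zE /= /f opprB addrC subrK.
Qed.

End generator.

(** * The extrapolation space *)

Section extrapolation_space.
Variables (R : realType) (k : scalar_kind).
Local Notation K := (scalars R k).
Variables (E Em1 : completeNormedModType K) (T : R -> bop E E).
Variables (j : bop E Em1) (Tm1 : R -> bop Em1 Em1).
Hypotheses (hT : C0_semigroup T) (hT0 : (growth_bound T < 0)%E).
Hypothesis hE : is_extrapolation T j Tm1.

(** j y = 0 means that A^-1 y = 0.  As A is onto, the conventional value 0 of
    [generator_inv] outside the range of A does not occur, and y = A 0 = 0. *)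
Lemma extrapolation_injective : injective j.
Proof.
suff j0 y : j y = 0 -> y = 0.
  by move=> x y jxy; apply/subr0_eq/j0; rewrite bopB jxy subrr.
move=> jy; have [hj _ _] := hE.
have yT : generator T (generator_inv T y) y.
  have [x xy] := generator_surjective hT hT0 y.
  exact: (@xgetPex _ 0 [set x | generator T x y] (ex_intro _ x xy)).
have Ty0 : generator_inv T y = 0.
  by apply/eqP; rewrite -rnorm_eq0 -hj jy rnorm0.
move: yT; rewrite Ty0 => yT.
by have := @generatorZ _ _ _ _ 0 _ _ yT; rewrite !scale0r => /(generator_unique yT).
Qed.

End extrapolation_space.

(** * Generators of left implemented semigroups *)

Section implemented_generator.
Variables (R : realType) (k : scalar_kind).
Local Notation K := (scalars R k).

(** The boundedness required of a bi-continuous generator comes for free: the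
    difference quotients are pointwise bounded on ]0, 1], by convergence near 0
    and by continuity away from 0, hence norm bounded. *)
Lemma sot_generator_pointwiseP (X : completeNormedModType K)
    (Y : normedModType K) (W : R -> bop Y Y)
    (U : R -> bop (bop X Y) (bop X Y)) (C D : bop X Y) :
  (forall t, 0 <= t -> U t C = bop_comp (W t) C) ->
  (forall x, {within `[0, 1], continuous (fun t => W t (C x))}) ->
  sot_generator U C D <-> forall x, generator W (C x) (D x).
Proof.
move=> UW Wc; pose Q (t : R) : bop X Y := ofR k t^-1 *: (U t C - C).
have QE t x : 0 < t -> Q t x = ofR k t^-1 *: (W t (C x) - C x).
  by move=> t0; rewrite /Q UW ?ltW.
have cvgQ : (Q t : sot X Y) @[t --> 0^'+] --> (D : sot X Y) <->
    forall x, generator W (C x) (D x).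
  have QW x : \forall t \near 0^'+, Q t x = ofR k t^-1 *: (W t (C x) - C x).
    by apply/near_right0P; exists 1 => // t t0 _; exact: QE.
  split=> [/sot_cvgP QD x|WD].
    have {}QD : Q t x @[t --> 0^'+] --> D x by exact: QD.
    rewrite /generator; apply: cvg_trans QD; apply: near_eq_cvg.
    by apply: filterS (QW x) => t ->.
  apply/sot_cvgP => x; suff : Q t x @[t --> 0^'+] --> D x by [].
  by apply: cvg_trans (WD x); apply: near_eq_cvg; apply: filterS (QW x) => t ->.
split; first by move=> [/cvgQ].
move=> WD; split; first exact/cvgQ.
have [|M MQ] := @uniform_boundedness _ _ _ _ (Q @` `]0, 1]).
  move=> x; have /cvg_rnormP/(_ 1 ltr01)/near_right0P[d d0 dP] := WD x.
  have [N NP] := within_continuous_bounded (Wc x).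
  exists (Num.max (1 + rnorm (D x)) (d^-1 * (N + rnorm (C x)))).
  move=> _ [t tI <-]; have /andP[t0 t1] : 0 < t <= 1.
    by move: tI; rewrite /= in_itv.
  rewrite QE//.
  rewrite le_max; have [td|dt] := ltP t d; apply/orP; [left|right].
    rewrite -[X in rnorm X](subrK (D x)) (le_trans (ler_rnormD _ _))// lerD2r.
    exact/ltW/dP.
  rewrite rnormZr gtr0_norm ?invr_gt0// ler_pM ?rnorm_ge0 ?invr_ge0 ?(ltW t0)//.
    by rewrite lef_pV2 ?posrE.
  by rewrite (le_trans (ler_rnormB _ _))// lerD2r NP// t1 ltW.
exists M => _ [t /= tI <-]; have := MQ (Q t) (ex_intro2 _ _ t tI erefl).
move: tI; rewrite in_itv/= => /andP[t0 _].
by rewrite /Q rnormZr gtr0_norm ?invr_gt0// mulrC.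
Qed.

End implemented_generator.

Section implemented.
Variables (R : realType) (k : scalar_kind).
Local Notation K := (scalars R k).
Variables (E Em1 : completeNormedModType K) (T S : R -> bop E E).
Variable V : R -> bop (bop E E) (bop E E).
Variables (j : bop E Em1) (Tm1 : R -> bop Em1 Em1).
Hypotheses (hT : C0_semigroup T) (hS : C0_semigroup S).
Hypothesis hV : left_implemented V S.
Hypothesis hE : is_extrapolation T j Tm1.

Lemma left_implemented_generatorP C D :
  sot_generator V C D <-> forall x, generator S (C x) (D x).
Proof.
apply: sot_generator_pointwiseP => [t t0|x]; first exact: hV.2.
exact: C0_semigroup_within.
Qed.

(** On the range of j, Tm1 inherits its strong continuity from T. *)
Lemma extrapolated_generatorP (C : bop E E) G :
  sot_generator (Um1 E Tm1) (jL j C) G <->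
  forall x, generator Tm1 (j (C x)) (G x).
Proof.
apply: sot_generator_pointwiseP => // x; have [_ _ jT] := hE.
have /subspace_continuousP Tc := @C0_semigroup_within _ _ _ T 0 1 (C x) hT (lexx 0).
apply: (@subspace_eq_continuous _ _ _ (fun t => j (T t (C x)))).
  by move=> t; rewrite inE/= in_itv/= => /andP[t0 _]; rewrite -jT.
by apply/subspace_continuousP => t t01; apply: bop_cvg; exact: Tc.
Qed.

Lemma part_in_LE_lmulP B C D :
  part_in_LE j Tm1 (lmul E B) C D <->
  forall x, part_in_E j Tm1 B (C x) (D x).
Proof.
split=> [[G /extrapolated_generatorP CG GE] x|CD].
  by exists (G x); rewrite // -[RHS]/(jL j D x) -GE.
exists (jL j D - bop_comp B C); last by rewrite subrK.
apply/extrapolated_generatorP => x; have [v Cv vE] := CD x.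
by rewrite [X in generator _ _ X](_ : _ = v)// -[v](addrK (B (C x))) vE.
Qed.

(** To pass from operators to vectors x and y, take for C and D the operators
    phi(.)x and phi(.)y for a functional phi with phi(e) = 1, and evaluate at
    e. *)
Lemma generator_transferP B :
  (forall C D, sot_generator V C D <-> part_in_LE j Tm1 (lmul E B) C D) <->
  (forall x y, generator S x y <-> part_in_E j Tm1 B x y).
Proof.
split=> [VB x y|SB C D]; last first.
  rewrite left_implemented_generatorP part_in_LE_lmulP.
  by split=> + x => /(_ x)/SB.
have gen0 (X : normedModType K) (W : R -> bop X X) : generator W 0 0.
  rewrite /generator; under eq_fun do rewrite bop0 subrr scaler0.
  exact: cvg_cst.
have part0 : part_in_E j Tm1 B 0 0.
  by exists 0; rewrite !bop0 ?addr0//; exact: gen0.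
have partZ a z w : part_in_E j Tm1 B z w -> part_in_E j Tm1 B (a *: z) (a *: w).
  move=> [v zv vE]; exists (a *: v); rewrite bopZ; first exact: generatorZ.
  by rewrite bopZ -scalerDr vE.
have [E0|/existsNP[z0 /eqP]] := pselect (forall z : E, z = 0).
  by rewrite (E0 x) (E0 y).
move=> /norming_functional[phi [e [phil phi_le _ phie]]].
pose C := rank_one phil phi_le x; pose D := rank_one phil phi_le y.
have Ce : C e = x by rewrite /C/= phie scale1r.
have De : D e = y by rewrite /D/= phie scale1r.
have := VB C D; rewrite left_implemented_generatorP part_in_LE_lmulP => CD.
split=> xy.
  by rewrite -Ce -De; apply: CD.1 => z; exact: generatorZ.
by rewrite -Ce -De; apply: CD.2 => z; exact: partZ.
Qed.

(** On the domain of the generator, (P C) x is the difference of j (D x) and of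
    the generator of Tm1 at j (C x), so P commutes there with right
    multiplication; strong continuity extends this to the identity, the strong
    limit of means of S. *)
Lemma perturbation_left_multiplication (P : bop (bop E E) (bop E Em1)) :
  continuous (P : sot E E -> sot E Em1) ->
  (forall C D, sot_generator V C D -> part_in_LE j Tm1 P C D) ->
  P = lmul E (P (bop_id E)).
Proof.
move=> Pc VP.
have VPx (C D : bop E E) : (forall x, generator S (C x) (D x)) ->
    forall x, generator Tm1 (j (C x)) (j (D x) - P C x).
  move=> /left_implemented_generatorP/VP[G /extrapolated_generatorP CG GE] x.
  rewrite [X in generator _ _ X](_ : _ = G x)//.
  by rewrite -[j (D x)]/(jL j D x) -GE bopDE addrK.
have P_comp (C D : bop E E) : (forall x, generator S (C x) (D x)) ->
    forall Q, P (bop_comp C Q) = bop_comp (P C) Q.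
  move=> CD Q; apply: bop_ext => x.
  have CQ := VPx (bop_comp C Q) (bop_comp D Q) (fun x => CD (Q x)) x.
  have := generator_unique CQ (VPx C D CD (Q x)).
  by move=> /addrI/oppr_inj.
have n0 n : 0 < n.+1%:R^-1 :> R by rewrite invr_gt0.
have /choice[C CP] n := semigroup_mean hS (n0 n).
have C_comp n Q : P (bop_comp (C n) Q) = bop_comp (P (C n)) Q.
  apply: (P_comp _ (ofR k n.+1%:R^-1^-1 *: (S n.+1%:R^-1 - bop_id E))) => x.
  exact: (CP n).1.
have Ccvg x : C n x @[n --> \oo] --> x.
  apply/cvg_rnormP => e e0.
  have e20 : 0 < e / 2 by rewrite divr_gt0.
  have /within_continuous_rnormP/(_ 0) := @C0_semigroup_within _ _ _ S 0 1 x hS (lexx 0).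
  rewrite /= in_itv/= lexx ler01 => /(_ isT _ e20)[d d0 dP].
  have /cvgrPdistC_lt/(_ d d0) := @cvg_harmonic R.
  apply: filterS => n; rewrite subr0 /harmonic/= gtr0_norm// => nd.
  rewrite (le_lt_trans ((CP n).2 x (e / 2) _))//; last first.
    by rewrite ltr_pdivrMr// ltr_pMr// ltr1n.
  move=> s /andP[s0 sn]; rewrite -[X in _ - X](_ : S 0 x = x); last by rewrite hS.1.1.
  apply/ltW/dP; last by rewrite subr0 ger0_norm// (le_lt_trans sn).
  by rewrite /= in_itv/= s0 (le_trans sn)// invf_le1// ler1n.
have sot_cvg (Q : nat -> bop E E) (l : bop E E) :
    (forall x, Q n x @[n --> \oo] --> l x) ->
    forall x, P (Q n) x @[n --> \oo] --> P l x.
  move=> Ql x.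
  have Ql' : (Q n : sot E E) @[n --> \oo] --> (l : sot E E) by exact/sot_cvgP.
  have PQl : (P (Q n) : sot E Em1) @[n --> \oo] --> (P l : sot E Em1).
    exact: (cvg_comp _ _ Ql' (Pc l)).
  exact: ((sot_cvgP _ _).1 PQl x).
apply: bop_ext => Q; apply: bop_ext => x.
have PQ := sot_cvg (fun n => bop_comp (C n) Q) Q (fun x => Ccvg (Q x)) x.
have PI := sot_cvg C (bop_id E) Ccvg (Q x).
apply: (cvg_unique _ PQ) => //=.
by under eq_fun do rewrite C_comp.
Qed.

End implemented.

(** * Riemann integrals and sup norms *)

Section riemann_integral.
Variable R : realType.

Lemma fine_partitions_filter (a b : R) : Filter (fine_partitions a b).
Proof.
apply: filter_from_filter; first by exists 1 => /=.
move=> d e /= d0 e0; exists (Num.min d e); first by rewrite /= lt_min d0.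
move=> P [tP fP]; split; split=> // i iP;
  by have := fP i iP; rewrite lt_min => /andP[].
Qed.

Lemma fine_partitions_proper (a b : R) : a <= b ->
  ProperFilter (fine_partitions a b).
Proof.
move=> ab; apply: filter_from_proper; first exact: fine_partitions_filter.
move=> d /= d0; pose n := (Num.truncn ((b - a) / d)).+1.
have n0 : 0 < n%:R :> R by rewrite ltr0n.
pose x (i : nat) := a + i%:R * ((b - a) / n%:R).
have xS i : x i.+1 - x i = (b - a) / n%:R.
  by rewrite /x opprD addrACA subrr add0r -mulrBl -natrB// subSnn mul1r.
have dx : 0 <= (b - a) / n%:R by rewrite divr_ge0// subr_ge0.
exists (TaggedPartition n x x); split.
  split=> [||i _] /=; first by rewrite /x mul0r addr0.
  - by rewrite /x mulrCA divff ?gt_eqF// mulr1 addrC subrK.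
  - by rewrite lexx /= -subr_ge0 xS.
move=> i _ /=; rewrite xS ltr_pdivrMr// mulrC -ltr_pdivrMr//.
exact: truncnS_gt.
Qed.

Variable k : scalar_kind.
Local Notation K := (scalars R k).

Lemma riemann_integral_unique (V : normedModType K) (f : R -> V) (a b : R) l m :
  a <= b -> is_riemann_integral f a b l -> is_riemann_integral f a b m -> l = m.
Proof.
move=> ab fl fm; have FF := fine_partitions_proper ab.
exact: (cvg_unique _ fl fm).
Qed.

Lemma riemann_integral_linear (V : normedModType K) (f g : R -> V) (a b : R)
    (c : K) l m :
  is_riemann_integral f a b l -> is_riemann_integral g a b m ->
  is_riemann_integral (fun r => c *: f r + g r) a b (c *: l + m).
Proof.
move=> fl gm; have FF := fine_partitions_filter a b.
rewrite /is_riemann_integral.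
have -> : (fun P => riemann_sum (fun r => c *: f r + g r) P) =
    (fun P => c *: riemann_sum f P + riemann_sum g P).
  apply/funext => P; rewrite /riemann_sum scaler_sumr -big_split/=.
  by apply: eq_bigr => i _; rewrite scalerDr !scalerA mulrC.
by apply: cvgD => //; exact: cvgZr.
Qed.

Lemma sot_riemann_integralP (E F : normedModType K) (f : R -> bop E F)
    (a b : R) (l : bop E F) :
  is_sot_riemann_integral f a b l <->
  forall x, is_riemann_integral (fun r => f r x) a b (l x).
Proof.
have FF := fine_partitions_filter a b.
have sumE P x : riemann_sum f P x = riemann_sum (fun r => f r x) P.
  by rewrite /riemann_sum; elim/big_ind2 : _ => // u v w z <- <-.
have sumE' x : (fun P => riemann_sum f P x) = riemann_sum (fun r => f r x).
  by apply/funext => P; exact: sumE.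
split=> [fl x|fl].
  rewrite /is_riemann_integral -sumE'; exact: ((sot_cvgP _ _).1 fl x).
apply/sot_cvgP => x.
suff : riemann_sum f P x @[P --> fine_partitions a b] --> l x by [].
by rewrite sumE'; exact: fl.
Qed.

End riemann_integral.

Section sup_norm.
Variables (R : realType) (k : scalar_kind) (V : normedModType (scalars R k)).
Variables (t0 : R).
Hypothesis t0_ge0 : 0 <= t0.

Lemma sup_norm_le (F : R -> V) (c : R) :
  (forall t, 0 <= t <= t0 -> rnorm (F t) <= c) -> sup_norm t0 F <= c.
Proof.
move=> Fc; apply: ge_sup; last first.
  by move=> _ [t + <-]; rewrite /= in_itv => /Fc.
by exists (rnorm (F 0)), 0; rewrite //= in_itv/= lexx.
Qed.

Lemma le_sup_norm (F : R -> V) (M : R) t :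
  (forall t, 0 <= t <= t0 -> rnorm (F t) <= M) -> 0 <= t <= t0 ->
  rnorm (F t) <= sup_norm t0 F.
Proof.
move=> FM tt0; have ts : [set` `[0, t0]] t by rewrite /= in_itv.
apply: sup_upper_bound; last by exists t.
split; first by exists (rnorm (F t)), t.
by exists M => _ [s + <-]; rewrite /= in_itv => /FM.
Qed.

Lemma space_opnorm_lt1P (X : set (R -> V)) (Phi : (R -> V) -> (R -> V)) :
  (space_opnorm t0 X Phi < 1)%E <->
  exists2 q : R, 0 <= q < 1 &
    forall F, X F -> sup_norm t0 F <= 1 -> sup_norm t0 (Phi F) <= q.
Proof.
split=> [|[q /andP[q0 q1] Xq]]; last first.
  apply: (@le_lt_trans _ _ q%:E); last by rewrite lte_fin.
  by apply: ge_ereal_sup => _ [F [XF F1] <-]; rewrite lee_fin Xq.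
have ub F : X F -> sup_norm t0 F <= 1 ->
    ((sup_norm t0 (Phi F))%:E <= space_opnorm t0 X Phi)%E.
  by move=> XF F1; apply: ereal_sup_ubound; exists F.
case: (space_opnorm t0 X Phi) ub => [r||] // ub r1.
  exists (Num.max r 0); first by rewrite le_max lexx orbT gt_max -lte_fin r1/=.
  by move=> F XF F1; rewrite le_max -lee_fin ub.
exists 0; first by rewrite lexx ltr01.
by move=> F XF F1; have := ub F XF F1.
Qed.

End sup_norm.

(** * Admissible perturbations *)

Section Desch_Schappacher.
Variables (R : realType) (k : scalar_kind).
Local Notation K := (scalars R k).
Variables (E Em1 : completeNormedModType K) (t0 : R) (t0_ge0 : 0 <= t0).
Variables (j : bop E Em1) (Tm1 : R -> bop Em1 Em1) (j_inj : injective j).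
Local Notation LE := (bop E E).

Lemma rnorm_bop_comp (X Y Z : normedModType K) (f : bop Y Z) (g : bop X Y) :
  rnorm (bop_comp f g) <= rnorm f * rnorm g.
Proof.
apply: rnorm_bop_le => [|x]; first by rewrite mulr_ge0 ?rnorm_ge0.
rewrite (le_trans (ler_rnorm_bop f _))// -mulrA ler_wpM2l ?rnorm_ge0//.
exact: ler_rnorm_bop.
Qed.

Lemma lmul_sot_continuous (B : bop E Em1) :
  continuous (lmul E B : sot E E -> sot E Em1).
Proof.
move=> C; have FC : Filter (nbhs (C : sot E E)) by exact: nbhs_filter.
have gx x : g x @[g --> nbhs (C : sot E E)] --> C x.
  exact: ((@sot_cvgP _ _ _ _ (nbhs (C : sot E E)) C FC).1 (fun A => id) x).
apply: (@sot_cvgP _ _ _ _ (lmul E B @ nbhs (C : sot E E)) (lmul E B C) _).2 => x.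
exact: (@bop_cvg _ _ _ _ B _ (nbhs (C : sot E E)) (fun g : bop E E => g x) (C x) FC (gx x)).
Qed.

(** Bi-equicontinuity holds because (lmul (G r) C) x = G(r)(C x) and G is
    norm bounded. *)
Lemma frakX_lmul (G : R -> LE) : sot_continuous_functions t0 G ->
  frakX t0 (fun r => lmul E (G r)).
Proof.
move=> Gc; have [M GM] := sot_within_continuous_bounded Gc; split.
- exists M => t /GM tM; apply: le_trans tM.
  by apply: rnorm_bop_le => [|C]; rewrite ?rnorm_ge0// rnorm_bop_comp.
- move=> C; apply/sot_within_continuousP => x.
  by have /sot_within_continuousP/(_ (C x)) := Gc.
- move=> C _ C0 x e e0.
  have Cx : C n x @[n --> \oo] --> (0 : E) by exact: ((sot_cvgP _ _).1 C0 x).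
  have M1 : 0 < `|M| + 1 by rewrite ltr_wpDl.
  have /cvg_rnormP/(_ _ (divr_gt0 e0 M1)) := Cx; apply: filterS => n.
  rewrite subr0 ltr_pdivlMr// => ne _ [t + <-]; rewrite /= in_itv => /GM tM.
  rewrite (le_lt_trans _ ne)// mulrC (le_trans (ler_rnorm_bop _ _))//.
  rewrite ler_wpM2r ?rnorm_ge0// (le_trans tM)// (le_trans (ler_norm _))//.
  by rewrite lerDl.
Qed.

Lemma frakX_eval (F : R -> bop LE LE) (C : LE) : frakX t0 F ->
  sot_continuous_functions t0 (fun r => F r C).
Proof. by move=> [_ Fc _]; exact: Fc. Qed.

(** V_B G is V_K applied to r |-> lmul (G r) and evaluated at the identity; its
    bound is inherited because |lmul (G r)| <= |G r| and |I| <= 1. *)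
Lemma sot_DS_admissible_restrict (B : bop E Em1) :
  sot_DS_admissible t0 j Tm1 (lmul E B) -> DS_admissible t0 j Tm1 B.
Proof.
move=> [_ [VK [VKint VKX /space_opnorm_lt1P[q q1 VKq]]]].
pose I := bop_id E.
exists (fun G t => VK (fun r => lmul E (G r)) t I); split.
- move=> G /frakX_lmul GX t x tt0.
  exact: ((sot_riemann_integralP _ _ _ _).1 (VKint _ GX t I tt0) x).
- by move=> G /frakX_lmul/VKX/(@frakX_eval _ I).
apply/space_opnorm_lt1P; exists q => // G Gc G1.
have GX := frakX_lmul Gc; have [[M VM] _ _] := VKX _ GX.
have [N GN] := sot_within_continuous_bounded Gc.
have I1 : rnorm I <= 1 by apply: rnorm_bop_le => // x; rewrite mul1r.
apply: (sup_norm_le t0_ge0) => t tt0.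
rewrite (le_trans (ler_rnorm_bop _ _))//.
rewrite (le_trans (ler_wpM2l (rnorm_ge0 _) I1))// mulr1.
rewrite (le_trans (le_sup_norm VM tt0))// VKq//.
apply: (sup_norm_le t0_ge0) => r rt0.
apply: rnorm_bop_le => // C; rewrite (le_trans (rnorm_bop_comp _ _))//.
rewrite ler_wpM2r ?rnorm_ge0// (le_trans _ G1)//.
exact: (le_sup_norm GN).
Qed.

Section lift.
Variables (B : bop E Em1) (VB : (R -> LE) -> (R -> LE)).
Hypothesis VBint : is_VB t0 j Tm1 B VB.
Hypothesis VBc : forall G, sot_continuous_functions t0 G ->
  sot_continuous_functions t0 (VB G).
Variables (q : R) (q0 : 0 <= q).
Hypothesis VBq : forall G, sot_continuous_functions t0 G ->
  sup_norm t0 G <= 1 -> sup_norm t0 (VB G) <= q.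

(** The value of V_B G at x only depends on r |-> G(r) x, and linearly so: this
    holds for the integral that defines it, and j is injective. *)
Lemma VB_linear (G G1 G2 : R -> LE) (a : K) (x x1 x2 : E) t :
  sot_continuous_functions t0 G -> sot_continuous_functions t0 G1 ->
  sot_continuous_functions t0 G2 ->
  (forall r, G r x = a *: G1 r x1 + G2 r x2) -> 0 <= t <= t0 ->
  VB G t x = a *: VB G1 t x1 + VB G2 t x2.
Proof.
move=> Gc G1c G2c GE tt0; have /andP[t_ge0 _] := tt0.
apply: j_inj; apply: (riemann_integral_unique t_ge0 (VBint Gc tt0)).
have -> : (fun r => Tm1 (t - r) (B (G r x))) =
    (fun r => a *: Tm1 (t - r) (B (G1 r x1)) + Tm1 (t - r) (B (G2 r x2))).
  by apply/funext => r; rewrite GE !(bopD, bopZ).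
rewrite bopD bopZ; apply: riemann_integral_linear; exact: VBint.
Qed.

(** If |G(r) x| <= d, then H(r) = G(r) o Q with Q = phi(.) x/d has norm at most
    1 for a functional phi of norm 1, and (V_B H)(t) is phi(.) (V_B G)(t) x/d.
    Evaluating at a unit vector e with phi(e) = 1 turns the bound on V_B H into
    the claim.  The case c = 0 follows by approximation. *)
Lemma VB_pointwise_bound (G : R -> LE) (x : E) (c : R) :
  sot_continuous_functions t0 G -> 0 <= c ->
  (forall r, 0 <= r <= t0 -> rnorm (G r x) <= c) ->
  forall t, 0 <= t <= t0 -> rnorm (VB G t x) <= q * c.
Proof.
move=> Gc; suff pos d : 0 < d ->
    (forall r, 0 <= r <= t0 -> rnorm (G r x) <= d) ->
    forall t, 0 <= t <= t0 -> rnorm (VB G t x) <= q * d.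
  move=> c0 Gxc t tt0; apply/ler_addgt0Pr => e e0.
  have q1 : 0 < q + 1 by rewrite ltr_wpDl.
  have d0 : 0 < c + e / (q + 1) by rewrite ltr_wpDl// divr_gt0.
  rewrite (le_trans (pos _ d0 _ t tt0))//.
    by move=> r /Gxc /le_trans; apply; rewrite lerDl ltW// divr_gt0.
  rewrite mulrDr lerD2l mulrA ler_pdivrMr// mulrDr mulr1 [e * q]mulrC.
  by rewrite lerDl ltW.
move=> d0 Gxd t tt0.
have [->|/norming_functional[phi [e [phil phi_le e1 phie]]]] := eqVneq x 0.
  by rewrite bop0 rnorm0 mulr_ge0// ltW.
pose Q := rank_one phil phi_le (ofR k d^-1 *: x).
pose H r := bop_comp (G r) Q.
have Hc : sot_continuous_functions t0 H.
  apply/sot_within_continuousP => z.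
  by have /sot_within_continuousP/(_ (Q z)) := Gc.
have He s : 0 <= s <= t0 -> VB H s e = ofR k d^-1 *: VB G s x.
  move=> st0; rewrite (@VB_linear H G G (ofR k d^-1) e x 0 s)//.
    by rewrite bop0 addr0.
  by move=> r; rewrite /H/= phie scale1r bop0 addr0 bopZ.
have H1 : sup_norm t0 H <= 1.
  apply: (sup_norm_le t0_ge0) => r rt0; apply: rnorm_bop_le => // z.
  have dG : d^-1 * rnorm (G r x) <= 1 by rewrite ler_pdivrMl// mulr1 Gxd.
  have phiz : toR `|phi z| <= rnorm z by rewrite -(ler_ofR k) toR_norm rnormE.
  rewrite mul1r /H /= !bopZ rnormZ rnormZr [`|d^-1|]gtr0_norm ?invr_gt0//.
  rewrite -[leRHS]mulr1 ler_pM// ?mulr_ge0 ?invr_ge0 ?rnorm_ge0 ?(ltW d0)//.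
have [N HN] := sot_within_continuous_bounded (VBc Hc).
have := le_trans (le_sup_norm HN tt0) (VBq Hc H1).
move=> /(ler_wpM2r (rnorm_ge0 e)) /(le_trans (ler_rnorm_bop _ _)).
have -> : rnorm e = 1 by rewrite /rnorm e1 -(ofR1 R k) ofRK.
by rewrite He// mulr1 rnormZr gtr0_norm ?invr_gt0// ler_pdivrMl// mulrC.
Qed.

(** (V_K F)(t) C = V_B (F(.) C)(t).  This is linear and bounded in C only for F in
    the domain of V_K and t in [0, t0]; elsewhere an arbitrary value is chosen. *)
Let VK (F : R -> bop LE LE) (t : R) : bop LE LE :=
  xget (0 : bop LE LE) [set Phi : bop LE LE | forall C, Phi C = VB (fun r => F r C) t].

Let rnorm_VB F C t M : frakX t0 F ->
  (forall r, 0 <= r <= t0 -> rnorm (F r) <= M) -> 0 <= t <= t0 ->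
  rnorm (VB (fun r => F r C) t) <= q * M * rnorm C.
Proof.
move=> FX FM tt0; have M0 : 0 <= M by apply: le_trans (FM _ tt0); exact: rnorm_ge0.
apply: rnorm_bop_le => [|x]; first by rewrite !mulr_ge0// rnorm_ge0.
rewrite -!mulrA; apply: VB_pointwise_bound => //; first exact: frakX_eval.
  by rewrite !mulr_ge0// rnorm_ge0.
move=> r rt0; rewrite (le_trans (ler_rnorm_bop _ _))// mulrA.
rewrite ler_wpM2r ?rnorm_ge0// (le_trans (ler_rnorm_bop _ _))//.
by rewrite ler_wpM2r ?rnorm_ge0// FM.
Qed.

Let VKE F C t : frakX t0 F -> 0 <= t <= t0 ->
  VK F t C = VB (fun r => F r C) t.
Proof.
move=> FX tt0; have [[M FM] _ _] := FX.
have Vl : linear (fun C : LE => VB (fun r => F r C) t).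
  move=> a C1 C2; apply: bop_ext => x; rewrite bopDE bopZE.
  apply: VB_linear => //; try exact: frakX_eval.
  by move=> r; rewrite bopD bopZ.
have Vb (C' : LE) : rnorm (VB (fun r => F r C') t) <= q * M * rnorm C'.
  exact: rnorm_VB.
rewrite /VK; case: xgetP => [Phi _ ->//|].
by move=> /(_ (Bop (bounded_linear_rnorm Vl Vb)))/=.
Qed.

Lemma DS_admissible_lift : q < 1 -> sot_DS_admissible t0 j Tm1 (lmul E B).
Proof.
move=> q1; split; first exact: lmul_sot_continuous.
have VKb F M : frakX t0 F -> (forall r, 0 <= r <= t0 -> rnorm (F r) <= M) ->
    forall t, 0 <= t <= t0 -> rnorm (VK F t) <= q * M.
  move=> FX FM t tt0; have M0 : 0 <= M by apply: le_trans (FM _ tt0); exact: rnorm_ge0.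
  apply: rnorm_bop_le => [|C]; first by rewrite mulr_ge0.
  by rewrite VKE//; exact: rnorm_VB.
exists VK; split.
- move=> F FX t C tt0; apply/sot_riemann_integralP => x.
  rewrite -[jL j _ x]/(j (VK F t C x)) VKE//.
  exact: (@VBint (fun r => F r C) (@frakX_eval _ C FX) t x tt0).
- move=> F FX; have [[M FM] _ Feq] := FX; split.
  + by exists (q * M) => t; exact: VKb.
  + move=> C; have := VBc (@frakX_eval _ C FX).
    apply: subspace_eq_continuous => t; rewrite inE/= in_itv/= => tt0.
    by rewrite [RHS](VKE _ FX tt0).
  + move=> C CM C0 x e e0; have := Feq C CM C0 x e e0.
    apply: filterS => n Fn _ [t + <-]; rewrite /= in_itv => tt0.
    have qe : q * e < e by rewrite gtr_pMl.
    rewrite VKE// (le_lt_trans _ qe)//; apply: VB_pointwise_bound => //.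
    * exact: frakX_eval.
    * exact: ltW.
    * by move=> r rt0; apply/ltW/Fn; exists r => //=; rewrite in_itv.
apply/space_opnorm_lt1P; exists q; rewrite ?q0// => F FX F1.
have [[M FM] _ _] := FX.
apply: (sup_norm_le t0_ge0) => t tt0; rewrite -[q]mulr1.
by apply: VKb => // r rt0; apply: le_trans F1; exact: le_sup_norm FM rt0.
Qed.

End lift.

Lemma sot_DS_admissible_lmul (B : bop E Em1) :
  sot_DS_admissible t0 j Tm1 (lmul E B) <-> DS_admissible t0 j Tm1 B.
Proof.
split; first exact: sot_DS_admissible_restrict.
move=> [VB [VBint VBc /space_opnorm_lt1P[q /andP[q0 q1] VBq]]].
exact: (@DS_admissible_lift B VB VBint VBc q q0 VBq q1).
Qed.

End Desch_Schappacher.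

(** * The equivalence *)

Theorem corollary5p7 (R : realType) (k : scalar_kind)
    (E : completeNormedModType (scalars R k))
    (t0 : R) (ht0 : 0 < t0)
    (T S : R -> bop E E)
    (hT : C0_semigroup T) (hS : C0_semigroup S)
    (hT0 : (growth_bound T < 0)%E)
    (U V : R -> bop (bop E E) (bop E E))
    (hU : left_implemented U T) (hV : left_implemented V S)
    (Em1 : completeNormedModType (scalars R k)) (j : bop E Em1)
    (Tm1 : R -> bop Em1 Em1) (hE : is_extrapolation T j Tm1) :
  (exists2 K : bop (bop E E) (bop E Em1),
     sot_DS_admissible t0 j Tm1 K &
     forall C D, sot_generator V C D <-> part_in_LE j Tm1 K C D)
  <->
  (exists2 B : bop E Em1,
     DS_admissible t0 j Tm1 B &
     forall x y, generator S x y <-> part_in_E j Tm1 B x y).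
Proof.
have j_inj := extrapolation_injective hT hT0 hE.
have DS B := @sot_DS_admissible_lmul _ _ _ _ _ (ltW ht0) j Tm1 j_inj B.
have gen B := generator_transferP hT hS hV hE B.
split=> [[K Kadm KV]|[B /DS Badm /gen BS]]; last by exists (lmul E B).
have KE : K = lmul E (K (bop_id E)).
  apply: (perturbation_left_multiplication hT hS hV hE Kadm.1) => C D.
  by rewrite KV.
by exists (K (bop_id E)); [apply/DS; rewrite -KE|apply/gen; rewrite -KE].
Qed.
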